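(* Let $\mu$ be the nilpotent Lie bracket on $\mathbb{R}^4$ whose only non-trivial relations on the standard basis, up to skew-symmetry, are $\mu(e_1,e_2)=e_3$ and $\mu(e_1,e_3)=e_4$. Then $(\mathbb{R}^4,g_\mu)$ is a Bach soliton. Moreover, this soliton is expanding and non-gradient, and it is the unique algebraic Bach soliton, up to isometry and scaling, within the orbit $\operatorname{GL}_4(\mathbb{R})\cdot\mu\subset\mathcal{N}_4$; that is, if $\nu\in\operatorname{GL}_4(\mathbb{R})\cdot\mu$ is an algebraic Bach soliton, then $g_\nu$ is isometric to $c\,g_\mu$ for some constant $c>0$.
   Context: $\mathcal{N}_4\subset\Lambda^2(\mathbb{R}^4)^*\otimes\mathbb{R}^4$ is the set of skew-symmetric bilinear maps $\mu:\mathbb{R}^4\times\mathbb{R}^4\to\mathbb{R}^4$ satisfying the Jacobi identity and nilpotent (every $\operatorname{ad}_\mu x=\mu(x,\cdot)$ is a nilpotent endomorphism). $\operatorname{GL}_4(\mathbb{R})$ acts by $h\cdot\mu=h\mu(h^{-1}\cdot,h^{-1}\cdot)$. For $\mu\in\mathcal{N}_4$, the simply connected Lie group with Lie algebra $(\mathbb{R}^4,\mu)$ is identified with $\mathbb{R}^4$ with product $x\cdot_\mu y=x+y+\frac12\mu(x,y)+\frac1{12}\mu(\mu(x,y),y)-\frac1{12}\mu(\mu(x,y),x)$, and $g_\mu$ is the left-invariant metric on $(\mathbb{R}^4,\cdot_\mu)$ which is the standard inner product on $T_0\mathbb{R}^4=\mathbb{R}^4$. The Bach tensor of a Riemannian 4-manifold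 is $\operatorname{B}(g)_{ij}=\nabla^k\nabla^l W_{kijl}+\tfrac12 R^{kl}W_{kijl}$, where $W$ is the Weyl tensor, $R^{kl}$ the Ricci tensor with raised indices, and the index convention is such that $R_{ij}=g^{kl}R_{kijl}$. The endomorphism $B_\mu$ of $\mathbb{R}^4$ is defined by $\operatorname{B}(g_\mu)(0)=\langle B_\mu\cdot,\cdot\rangle$, with $\langle\cdot,\cdot\rangle$ the standard inner product. A Bach soliton is a Riemannian 4-manifold with $\operatorname{B}(g)+\frac{\Delta s}{12}g=\lambda g+\mathcal{L}_Xg$ for a constant $\lambda\in\mathbb{R}$ and a complete vector field $X$, where $s$ is the scalar curvature (for homogeneous metrics $\Delta s=0$). It is expanding if $\lambda>0$. It is gradient if $\operatorname{B}(g)+\frac{\Delta s}{12}g=\lambda g+2\operatorname{Hess}u$ for some $u\in C^\infty(M)$ and $\lambda\in\mathbb{R}$; non-gradient means no such $u,\lambda$ exist. A bracket $\nu\in\mathcal{N}_4$ (or $(\mathbb{R}^4,g_\nu)$) is an algebraic Bach soliton if $B_\nu=\lambda I+D$ for some $\lambda\in\mathbb{R}$ and some derivation $D\in\operatorname{Der}(\nu)$ of the Lie algebra $(\mathbb{R}^4,\nu)$. *)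

(* Defs.v *)
From HB Require Import structures.
From mathcomp Require Import all_boot all_order all_algebra.
From mathcomp Require Import all_classical all_reals all_analysis.

Set Implicit Arguments.
Unset Strict Implicit.
Unset Printing Implicit Defensive.

Import Order.TTheory GRing.Theory Num.Theory.
Import numFieldNormedType.Exports.

Local Open Scope ring_scope.

(* R^4 is 'rV[R]_4, used both as a vector space and as a manifold covered by
   one chart.  Matrices act on vectors from the right: the endomorphism with
   matrix A is u |-> u *m A. *)

(* The standard basis e_ 1, e_ 2, e_ 3, e_ 4. *)
Definition e_ {R : realType} (n : nat) : 'rV[R]_4 := delta_mx 0 (inord n.-1).

Section Calculus.
Context {R : realType}.
Implicit Types (f : 'rV[R]_4 -> R) (p : 'rV[R]_4).

Definition partial (i : 'I_4) f p : R :=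
  'D_(delta_mx 0 i) (f : 'rV[R]_4 -> R^o) p.

Definition smooth f : Prop :=
  forall (s : seq 'I_4) p,
    differentiable (foldr partial f s : 'rV[R]_4 -> R^o) p.

Definition smooth_map (F : 'rV[R]_4 -> 'rV[R]_4) : Prop :=
  forall i, smooth (fun p => F p 0 i).

Definition complete_field (X : 'rV[R]_4 -> 'rV[R]_4) : Prop :=
  forall p, exists gam : R -> 'rV[R]_4,
    gam 0 = p /\ forall t : R, is_derive (t : R^o) (1 : R^o) gam (X (gam t)).

End Calculus.

Section Riemannian.
Context {R : realType}.
Implicit Types (g : 'rV[R]_4 -> 'M[R]_4) (p : 'rV[R]_4).

Definition riemannian_metric g : Prop :=
  [/\ forall i j, smooth (fun p => g p i j),
      forall p, (g p)^T = g p
    & forall p (v : 'rV[R]_4), v != 0 -> 0 < (v *m g p *m v^T) 0 0].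

(* phi is an isometry from g1 to g2 when phi^* g2 = g1; row i of the library's
   Jacobian 'J phi p is the image of the i-th basis vector. *)
Definition isometric (g1 g2 : 'rV[R]_4 -> 'M[R]_4) : Prop :=
  exists phi psi : 'rV[R]_4 -> 'rV[R]_4,
    [/\ smooth_map phi, smooth_map psi, cancel phi psi, cancel psi phi
      & forall p, 'J phi p *m g2 (phi p) *m ('J phi p)^T = g1 p].

Variable g : 'rV[R]_4 -> 'M[R]_4.

Definition ginv p : 'M[R]_4 := invmx (g p).

(* christoffel k i j = Gamma^k_{ij} *)
Definition christoffel (k i j : 'I_4) p : R :=
  2^-1 * \sum_l ginv p k l *
    (partial i (fun q => g q j l) p + partial j (fun q => g q i l) p
     - partial l (fun q => g q i j) p).

(* riemann_up l i j k is the l-th component of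
   R(d_i, d_j) d_k = nabla_i nabla_j d_k - nabla_j nabla_i d_k, and
   riemann i j k l = R_{ijkl} = <R(d_i, d_j) d_k, d_l>, so that the Ricci
   tensor, which is positive on round spheres, is R_{ij} = g^{kl} R_{kijl}. *)
Definition riemann_up (l i j k : 'I_4) p : R :=
  partial i (christoffel l j k) p - partial j (christoffel l i k) p
  + \sum_m (christoffel l i m p * christoffel m j k p
            - christoffel l j m p * christoffel m i k p).

Definition riemann (i j k l : 'I_4) p : R :=
  \sum_m g p l m * riemann_up m i j k p.

Definition ricci (i j : 'I_4) p : R :=
  \sum_k \sum_l ginv p k l * riemann k i j l p.

Definition scalar_curvature p : R :=
  \sum_i \sum_j ginv p i j * ricci i j p.

(* The trace-free part of the curvature, with the coefficients 1/(n-2) and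
   1/((n-1)(n-2)) for n = 4. *)
Definition weyl (i j k l : 'I_4) p : R :=
  riemann i j k l p
  - 2^-1 * (ricci i l p * g p j k + ricci j k p * g p i l
            - ricci i k p * g p j l - ricci j l p * g p i k)
  + 6^-1 * scalar_curvature p * (g p i l * g p j k - g p i k * g p j l).

(* A covariant r-tensor field is represented by its components, indexed by the
   lists of r indices; its values on lists of other lengths are irrelevant.
   The index created by the covariant derivative is put in front:
   nabla T (a :: s) = (nabla_a T)_s. *)
Definition tensor_field := seq 'I_4 -> 'rV[R]_4 -> R.

Definition nabla (T : tensor_field) : tensor_field := fun s p =>
  if s is a :: s' then
    partial a (T s') p
    - \sum_(r < size s') \sum_m
        christoffel m a (nth ord0 s' r) p * T (set_nth ord0 s' r m) p
  else 0.

Definition weyl_tensor : tensor_field := fun s p =>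
  if s is [:: i; j; k; l] then weyl i j k l p else 0.

Definition ricci_up (k l : 'I_4) p : R :=
  \sum_a \sum_b ginv p k a * ginv p l b * ricci a b p.

(* B_{ij} = nabla^k nabla^l W_{kijl} + 1/2 R^{kl} W_{kijl} *)
Definition bach (i j : 'I_4) p : R :=
  \sum_k \sum_l \sum_a \sum_b
     ginv p k a * ginv p l b
     * nabla (nabla weyl_tensor) [:: a; b; k; i; j; l] p
  + 2^-1 * \sum_k \sum_l ricci_up k l p * weyl k i j l p.

Definition hessian (u : 'rV[R]_4 -> R) (i j : 'I_4) p : R :=
  partial i (partial j u) p - \sum_k christoffel k i j p * partial k u p.

Definition laplacian (u : 'rV[R]_4 -> R) p : R :=
  \sum_i \sum_j ginv p i j * hessian u i j p.

Definition lie_metric (X : 'rV[R]_4 -> 'rV[R]_4) (i j : 'I_4) p : R :=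
  \sum_k (X p 0 k * partial k (fun q => g q i j) p
          + g p k j * partial i (fun q => X q 0 k) p
          + g p i k * partial j (fun q => X q 0 k) p).

Definition bach_soliton (lam : R) (X : 'rV[R]_4 -> 'rV[R]_4) : Prop :=
  [/\ riemannian_metric g, smooth_map X, complete_field X
    & forall i j p,
        bach i j p + laplacian scalar_curvature p / 12 * g p i j
        = lam * g p i j + lie_metric X i j p].

Definition gradient_soliton : Prop :=
  exists (u : 'rV[R]_4 -> R) (lam : R),
    smooth u /\
    forall i j p,
      bach i j p + laplacian scalar_curvature p / 12 * g p i j
      = lam * g p i j + 2 * hessian u i j p.

End Riemannian.

Section Brackets.
Context {R : realType}.
Implicit Types (mu nu : 'rV[R]_4 -> 'rV[R]_4 -> 'rV[R]_4).

Definition nilpotent_bracket mu : Prop :=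
  [/\ (forall x, linear (mu x)) /\ (forall y, linear (mu^~ y)),
      forall x y, mu x y = - mu y x,
      forall x y z, mu x (mu y z) + mu y (mu z x) + mu z (mu x y) = 0
    & forall x, exists n, forall y, iter n (mu x) y = 0].

Definition GL_orbit mu nu : Prop :=
  exists2 h : 'M[R]_4, h \in unitmx &
    forall x y, nu x y = mu (x *m invmx h) (y *m invmx h) *m h.

Definition group_mul mu (x y : 'rV[R]_4) : 'rV[R]_4 :=
  x + y + 2^-1 *: mu x y + 12^-1 *: mu (mu x y) y - 12^-1 *: mu (mu x y) x.

(* The inverse of p in the group is - p, so the left-invariant metric which is
   the standard inner product at 0 is, at p, the pullback of the standard inner
   product by the differential at p of left translation by - p. *)
Definition left_invariant_metric mu (p : 'rV[R]_4) : 'M[R]_4 :=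
  'J (group_mul mu (- p)) p *m ('J (group_mul mu (- p)) p)^T.

Definition bach_endo mu : 'M[R]_4 :=
  \matrix_(i, j) bach (left_invariant_metric mu) i j 0.

Definition derivation mu (D : 'M[R]_4) : Prop :=
  forall x y, mu x y *m D = mu (x *m D) y + mu x (y *m D).

Definition algebraic_bach_soliton mu : Prop :=
  exists (lam : R) (D : 'M[R]_4),
    derivation mu D /\ bach_endo mu = lam%:M + D.

End Brackets.

(* Main.v *)
Require Import Defs.
From HB Require Import structures.
From mathcomp Require Import all_boot all_order all_algebra.
From mathcomp Require Import all_classical all_reals all_analysis.
From mathcomp Require Import ring lra.
From Stdlib Require BinInt BinList Ring_theory Ring_polynom InitialRing.

Import Order.TTheory GRing.Theory Num.Theory.
Import numFieldNormedType.Exports.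

Local Open Scope ring_scope.

(* In a left-invariant orthonormal frame the Levi-Civita connection, the
   curvature and the Bach tensor have constant components, polynomial in the
   structure constants of the bracket.  Gram-Schmidt turns every bracket in the
   orbit, up to an orthogonal change of basis, into [e1, e2] = a e3 + b e4 and
   [e1, e3] = c e4 with a, c nonzero.  For these the components of the Bach
   tensor are computed explicitly: an algebraic soliton has b = 0 and
   a^2 = c^2, hence is a rescaling of mu up to a linear isomorphism, and for
   a = c = 1, b = 0 one finds B = (35/24) I + D with D a diagonal derivation,
   half of which is the soliton field.

   If the soliton were gradient, u being the potential, let v_d = E_d u.  Then
   E_c v_d = s_cd + sum_b G_cd^b v_b with s diagonal and G the connection
   coefficients.  Since e_4 is central and v_4 is affine along it, E_1 v_4,
   hence v_3, is invariant under translation by e_4, which forces v_1 = 0, then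
   v_3 = 0, and finally s_11 = s_33 = 0; but B_11 and B_33 differ. *)

(** * Polynomial functions on R^4 *)

(** Every geometric quantity is defined by coordinate derivatives, so a class of functions with
    computable derivatives is needed. Nilpotency provides one: the group law is polynomial, so the
    left-invariant coframe is a polynomial matrix, and it is unipotent up to a constant rotation, so
    its inverse is polynomial too. Christoffel symbols and coframe components of tensors therefore
    stay polynomial. Only the hypothetical potential [u] is merely smooth; for its sake the sum and
    product rules are stated for differentiable functions. The orthogonal change of basis [K] is
    absorbed into the coframe: [K^T *m coframe (p *m K^T)] has the same structure constants as the
    unrotated coframe, so the frame formula for the Bach tensor applies to both alike. That formula
    is a deeply nested finite sum, out of reach of rewriting. It is mirrored in reflected integer
    polynomials in a, b, c, evaluated by the kernel, and mapped back to the reals. *)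

Section PolynomialFunctions.
Context {R : realType}.
Implicit Types (f : 'rV[R]_4 -> R) (p : 'rV[R]_4).

Inductive pexp : Type :=
  | Cst of R | Var of 'I_4 | Add of pexp & pexp | Mul of pexp & pexp.

Fixpoint evalp (e : pexp) (p : 'rV[R]_4) : R :=
  match e with
  | Cst c => c
  | Var i => p 0 i
  | Add e1 e2 => evalp e1 p + evalp e2 p
  | Mul e1 e2 => evalp e1 p * evalp e2 p
  end.

Fixpoint deriv_pexp (i : 'I_4) (e : pexp) : pexp :=
  match e with
  | Cst _ => Cst 0
  | Var j => Cst (i == j)%:R
  | Add e1 e2 => Add (deriv_pexp i e1) (deriv_pexp i e2)
  | Mul e1 e2 => Add (Mul (deriv_pexp i e1) e2) (Mul e1 (deriv_pexp i e2))
  end.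

Lemma differentiable_coord0 i p :
  differentiable (fun q : 'rV[R]_4 => q 0 i : R^o) p.
Proof. exact: differentiable_coord. Qed.

Lemma partialD i f1 f2 p :
  differentiable (f1 : _ -> R^o) p -> differentiable (f2 : _ -> R^o) p ->
  partial i (fun q => f1 q + f2 q) p = partial i f1 p + partial i f2 p.
Proof. by move=> d1 d2; apply: deriveD; apply: diff_derivable. Qed.

Lemma partialM i f1 f2 p :
  differentiable (f1 : _ -> R^o) p -> differentiable (f2 : _ -> R^o) p ->
  partial i (fun q => f1 q * f2 q) p =
  partial i f1 p * f2 p + f1 p * partial i f2 p.
Proof.
move=> d1 d2; rewrite /partial; have := @deriveM R _ f1 f2 p (delta_mx 0 i).
move=> ->; try exact: diff_derivable.
by rewrite /GRing.scale /= addrC [f2 p * _]mulrC.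
Qed.

Lemma partial_cst i (c : R) p : partial i (fun=> c) p = 0.
Proof. exact: derive_cst. Qed.

Lemma partial_coord i j p : partial i (fun q => q 0 j) p = (i == j)%:R.
Proof.
rewrite /partial deriveE; last exact: differentiable_coord0.
have lin : linear (fun q : 'rV[R]_4 => q 0 j : R^o).
  by move=> c u v; rewrite !mxE.
pose L := GRing.isLinear.Build R 'rV[R]_4 R^o *:%R (fun q => q 0 j) lin.
pose F : {linear 'rV[R]_4 -> R^o} := HB.pack (fun q : 'rV[R]_4 => q 0 j : R^o) L.
rewrite (_ : 'd _ p = F :> (_ -> _)) /= ?mxE ?eqxx 1?eq_sym //.
apply: (@diff_lin _ _ _ F) => q; exact: coord_continuous.
Qed.

Lemma differentiableD_fun f1 f2 p :
  differentiable (f1 : _ -> R^o) p -> differentiable (f2 : _ -> R^o) p ->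
  differentiable (fun q => f1 q + f2 q : R^o) p.
Proof. exact: differentiableD. Qed.

Lemma differentiableM_fun f1 f2 p :
  differentiable (f1 : _ -> R^o) p -> differentiable (f2 : _ -> R^o) p ->
  differentiable (fun q => f1 q * f2 q : R^o) p.
Proof. exact: differentiableM. Qed.

Lemma differentiable_evalp e p : differentiable (evalp e : _ -> R^o) p.
Proof.
elim: e => [c|i|e1 IH1 e2 IH2|e1 IH1 e2 IH2] /=.
- exact: differentiable_cst.
- exact: differentiable_coord0.
- exact: differentiableD_fun.
- exact: differentiableM_fun.
Qed.

Lemma partial_evalp i e : partial i (evalp e) = evalp (deriv_pexp i e).
Proof.
apply/funext => p; elim: e => [c|j|e1 IH1 e2 IH2|e1 IH1 e2 IH2] /=.
- exact: partial_cst.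
- exact: partial_coord.
- by rewrite partialD ?IH1 ?IH2 //; apply: differentiable_evalp.
- by rewrite partialM ?IH1 ?IH2 //; apply: differentiable_evalp.
Qed.

(** Symmetry of second derivatives, read off the syntax. It later cancels the second derivatives of
    the coframe in the curvature. *)
Lemma deriv_pexpC i j e p :
  evalp (deriv_pexp i (deriv_pexp j e)) p = evalp (deriv_pexp j (deriv_pexp i e)) p.
Proof.
elim: e => [c|k|e1 IH1 e2 IH2|e1 IH1 e2 IH2] //=; rewrite IH1 IH2 //.
by rewrite -!addrA; congr (_ + _); rewrite addrCA.
Qed.

Definition polyf f := exists e, f = evalp e.

Lemma polyf_cst c : polyf (fun=> c). Proof. by exists (Cst c). Qed.

Lemma polyf_coord i : polyf (fun p => p 0 i). Proof. by exists (Var i). Qed.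

Lemma polyfD f1 f2 : polyf f1 -> polyf f2 -> polyf (fun p => f1 p + f2 p).
Proof. by move=> [e1 ->] [e2 ->]; exists (Add e1 e2). Qed.

Lemma polyfM f1 f2 : polyf f1 -> polyf f2 -> polyf (fun p => f1 p * f2 p).
Proof. by move=> [e1 ->] [e2 ->]; exists (Mul e1 e2). Qed.

Lemma polyf_sum (I : Type) (r : seq I) (F : I -> 'rV[R]_4 -> R) :
  (forall i, polyf (F i)) -> polyf (fun p => \sum_(i <- r) F i p).
Proof.
move=> PF; elim: r => [|i r IH].
  by rewrite (_ : (fun _ => _) = fun=> 0); [exact: polyf_cst
    |apply/funext => p; rewrite big_nil].
rewrite (_ : (fun _ => _) = fun p => F i p + \sum_(i <- r) F i p).
  exact: polyfD.
by apply/funext => p; rewrite big_cons.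
Qed.

Lemma polyf_diff f p : polyf f -> differentiable (f : _ -> R^o) p.
Proof. by move=> [e ->]; apply: differentiable_evalp. Qed.

Lemma polyf_partial i f : polyf f -> polyf (partial i f).
Proof. by move=> [e ->]; rewrite partial_evalp; exists (deriv_pexp i e). Qed.

Lemma polyf_smooth f : polyf f -> smooth f.
Proof.
move=> Pf s p; apply: polyf_diff.
by elim: s => //= i s; exact: polyf_partial.
Qed.

Lemma polyf_partialC i j f p :
  polyf f -> partial i (partial j f) p = partial j (partial i f) p.
Proof. by move=> [e ->]; rewrite !partial_evalp deriv_pexpC. Qed.

Lemma differentiable_sum_fun (I : Type) (r : seq I) (F : I -> 'rV[R]_4 -> R) p :
  (forall j, differentiable (F j : _ -> R^o) p) ->
  differentiable (fun q => \sum_(j <- r) F j q : R^o) p.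
Proof.
move=> dF; elim: r => [|j r IH].
  rewrite (_ : (fun _ => _) = fun=> 0); first exact: differentiable_cst.
  by apply/funext => q; rewrite big_nil.
rewrite (_ : (fun _ => _) = fun q => F j q + \sum_(j <- r) F j q).
  exact: differentiableD_fun.
by apply/funext => q; rewrite big_cons.
Qed.

Lemma partial_sum (I : Type) (r : seq I) i (F : I -> 'rV[R]_4 -> R) p :
  (forall j, differentiable (F j : _ -> R^o) p) ->
  partial i (fun q => \sum_(j <- r) F j q) p = \sum_(j <- r) partial i (F j) p.
Proof.
move=> dF; elim: r => [|j r IH].
  rewrite big_nil (_ : (fun _ => _) = fun=> 0) ?partial_cst //.
  by apply/funext => q; rewrite big_nil.
rewrite big_cons -IH -partialD //; last exact: differentiable_sum_fun.
by congr partial; apply/funext => q; rewrite big_cons.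
Qed.

Fixpoint subst_pexp (M : 'M[R]_4) (e : pexp) : pexp :=
  match e with
  | Cst c => Cst c
  | Var i => \big[Add/Cst 0]_(k < 4) Mul (Var k) (Cst (M k i))
  | Add e1 e2 => Add (subst_pexp M e1) (subst_pexp M e2)
  | Mul e1 e2 => Mul (subst_pexp M e1) (subst_pexp M e2)
  end.

Lemma evalp_big (I : Type) (r : seq I) (F : I -> pexp) p :
  evalp (\big[Add/Cst 0]_(i <- r) F i) p = \sum_(i <- r) evalp (F i) p.
Proof. by elim: r => [|i r IH]; rewrite ?(big_nil, big_cons) //= IH. Qed.

Lemma evalp_subst M e p : evalp (subst_pexp M e) p = evalp e (p *m M).
Proof.
elim: e => [c|i|e1 IH1 e2 IH2|e1 IH1 e2 IH2] //=; rewrite ?IH1 ?IH2 //.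
by rewrite evalp_big mxE.
Qed.

Lemma polyf_comp_lin f M : polyf f -> polyf (fun p => f (p *m M)).
Proof.
move=> [e ->]; exists (subst_pexp M e).
by apply/funext => p; rewrite evalp_subst.
Qed.

Lemma partial_comp_lin i f M p :
  polyf f ->
  partial i (fun q => f (q *m M)) p = \sum_k M i k * partial k f (p *m M).
Proof.
move=> [e ->].
rewrite (_ : (fun q => _) = evalp (subst_pexp M e)); last first.
  by apply/funext => q; rewrite evalp_subst.
rewrite partial_evalp.
under eq_bigr do rewrite partial_evalp.
elim: e => [c|j|e1 IH1 e2 IH2|e1 IH1 e2 IH2] /=.
- by rewrite big1 // => k _; rewrite mulr0.
- under [RHS]eq_bigr => k _ do rewrite mulr_natr.
  rewrite (bigD1 j) //= eqxx mulr1n big1 ?addr0 => [|k /negbTE->]; last first.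
    by rewrite mulr0n.
  have -> (r : seq 'I_4) : deriv_pexp i (\big[Add/Cst 0]_(k <- r) Mul (Var k) (Cst (M k j))) = 
     \big[Add/Cst 0]_(k <- r) deriv_pexp i (Mul (Var k) (Cst (M k j))).
    by elim: r => [|k r IH]; rewrite ?big_nil ?big_cons //= IH.
  rewrite evalp_big (bigD1 i) //= eqxx mul1r mulr0 addr0 big1 ?addr0 //.
  by move=> k /negbTE; rewrite eq_sym => ->; rewrite mul0r mulr0 addr0.
- by rewrite IH1 IH2 -big_split; apply: eq_bigr => k _; rewrite mulrDr.
- rewrite IH1 IH2 !evalp_subst mulr_suml mulr_sumr -big_split.
  by apply: eq_bigr => k _ /=; ring.
Qed.

Lemma jacobian_polyf (F : 'rV[R]_4 -> 'rV[R]_4) p i j :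
  (forall k, polyf (fun q => F q 0 k)) ->
  'J F p i j = partial i (fun q => F q 0 j) p.
Proof.
move=> PF.
have dF : differentiable F p.
  rewrite (_ : F = \sum_(k < 4) (fun q => F q 0 k *: delta_mx 0 k)); last first.
    by apply/funext => q; rewrite [LHS]row_sum_delta fct_sumE.
  apply: differentiable_sum => k; apply: differentiableZl; exact: polyf_diff.
have := deriveEjacobian (delta_mx 0 i) dF.
rewrite -rowE => /(congr1 (fun M : 'rV__ => M 0 j)); rewrite [RHS]mxE => <-.
rewrite derive_mx ?mxE //; exact: diff_derivable.
Qed.

End PolynomialFunctions.

(** * Curvature in a moving frame with constant structure coefficients *)

Section MatrixDerivative.
Context {R : realType}.
Implicit Types (F G : 'rV[R]_4 -> 'M[R]_4) (p : 'rV[R]_4).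

Definition polymx F := forall i j, polyf (fun p => F p i j).

Definition dmx (i : 'I_4) F p : 'M[R]_4 :=
  \matrix_(j, k) partial i (fun q => F q j k) p.

Lemma polymxM F G : polymx F -> polymx G -> polymx (fun p => F p *m G p).
Proof.
move=> PF PG i j; rewrite (_ : (fun _ => _) = fun p => \sum_k F p i k * G p k j).
  by apply: polyf_sum => k; apply: polyfM.
by apply/funext => p; rewrite mxE.
Qed.

Lemma polymxD F G : polymx F -> polymx G -> polymx (fun p => F p + G p).
Proof.
move=> PF PG i j; rewrite (_ : (fun _ => _) = fun p => F p i j + G p i j).
  exact: polyfD.
by apply/funext => p; rewrite mxE.
Qed.

Lemma polymx_dmx i F : polymx F -> polymx (dmx i F).
Proof.
move=> PF j k; rewrite (_ : (fun _ => _) = partial i (fun q => F q j k)).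
  exact: polyf_partial.
by apply/funext => p; rewrite mxE.
Qed.

Lemma polymxT F : polymx F -> polymx (fun p => (F p)^T).
Proof.
move=> PF i j; rewrite (_ : (fun _ => _) = fun p => F p j i) //.
by apply/funext => p; rewrite mxE.
Qed.

Lemma polymx_cst (M : 'M[R]_4) : polymx (fun=> M).
Proof. by move=> i j; exact: polyf_cst. Qed.

Lemma dmxM i F G p : polymx F -> polymx G ->
  dmx i (fun q => F q *m G q) p = dmx i F p *m G p + F p *m dmx i G p.
Proof.
move=> PF PG; apply/matrixP => j k; rewrite !mxE.
rewrite (_ : (fun _ => _) = fun p => \sum_l F p j l * G p l k); last first.
  by apply/funext => q; rewrite mxE.
rewrite partial_sum => [|l]; last by apply/polyf_diff/polyfM.
rewrite -big_split; apply: eq_bigr => l _ /=.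
by rewrite partialM ?mxE //; apply: polyf_diff.
Qed.

Lemma dmxD i F G p : polymx F -> polymx G ->
  dmx i (fun q => F q + G q) p = dmx i F p + dmx i G p.
Proof.
move=> PF PG; apply/matrixP => j k; rewrite !mxE.
rewrite (_ : (fun _ => _) = fun p => F p j k + G p j k); last first.
  by apply/funext => q; rewrite mxE.
by rewrite partialD //; apply: polyf_diff.
Qed.

Lemma dmxC i j F p : polymx F -> dmx i (dmx j F) p = dmx j (dmx i F) p.
Proof.
move=> PF; apply/matrixP => k l.
have e m : (fun q => dmx m F q k l) = partial m (fun q => F q k l).
  by apply/funext => q; rewrite mxE.
by rewrite [LHS]mxE [RHS]mxE !e polyf_partialC.
Qed.

End MatrixDerivative.

Section FrameEvaluation.
Context {R : realType}.
Variable th : 'M[R]_4.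
Implicit Types (t : seq 'I_4 -> R).

(* The coordinate components of the tensor whose components in the coframe
   th are t. *)
Fixpoint ev t (s : seq 'I_4) : R :=
  if s is i :: s' then \sum_a th i a * ev (fun u => t (a :: u)) s' else t [::].

Lemma eq_ev t1 t2 s : (forall u, size u = size s -> t1 u = t2 u) ->
  ev t1 s = ev t2 s.
Proof.
elim: s t1 t2 => [|i s IH] t1 t2 e /=; first exact: e.
apply: eq_bigr => a _; congr (_ * _); apply: IH => u su.
by apply: e; rewrite /= su.
Qed.

Lemma ev0 s : ev (fun=> 0) s = 0.
Proof. by elim: s => //= i s IH; rewrite big1 // => a _; rewrite IH mulr0. Qed.

Lemma evD t1 t2 s : ev (fun u => t1 u + t2 u) s = ev t1 s + ev t2 s.
Proof.
elim: s t1 t2 => //= i s IH t1 t2; rewrite -big_split; apply: eq_bigr => a _ /=.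
by rewrite IH mulrDr.
Qed.

Lemma evZ c t s : ev (fun u => c * t u) s = c * ev t s.
Proof.
elim: s t => //= i s IH t; rewrite mulr_sumr; apply: eq_bigr => a _ /=.
by rewrite IH mulrCA.
Qed.

Lemma evN t s : ev (fun u => - t u) s = - ev t s.
Proof. by rewrite -mulN1r -evZ; apply: eq_ev => u _; rewrite mulN1r. Qed.

Lemma ev_sum (I : Type) (r : seq I) (F : I -> seq 'I_4 -> R) s :
  ev (fun u => \sum_(j <- r) F j u) s = \sum_(j <- r) ev (F j) s.
Proof.
elim: r => [|j r IH].
  by rewrite big_nil -[RHS](ev0 s); apply: eq_ev => u _; rewrite big_nil.
by rewrite big_cons -IH -evD; apply: eq_ev => u _; rewrite big_cons.
Qed.

(** [ev] nests its sums in the order of the indices, whereas contractions and products need the sum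
    over a later index outermost. [take] and [drop] put [a] back in the slot that [l] occupied. *)
Lemma ev_pull t s1 l s2 :
  ev t (s1 ++ l :: s2) =
  \sum_a th l a * ev (fun u => t (take (size s1) u ++ a :: drop (size s1) u))
                     (s1 ++ s2).
Proof.
elim: s1 t => [|i s1 IH] t /=.
  by apply: eq_bigr => a _; congr (_ * _); apply: eq_ev => u _; rewrite take0 drop0.
under eq_bigr => b _ do rewrite IH mulr_sumr.
rewrite exchange_big; apply: eq_bigr => a _; rewrite mulr_sumr.
by apply: eq_bigr => b _; rewrite mulrCA.
Qed.

End FrameEvaluation.

Section FrameTensors.
Context {R : realType}.
Variable C : 'I_4 -> 'I_4 -> 'I_4 -> R.
Implicit Types (t : seq 'I_4 -> R).

(* The frame E_a has brackets [E_b, E_c] = \sum_a C b c a E_a, and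
   frame_conn b c a is the coefficient of E_a in nabla_{E_b} E_c. *)
Definition frame_conn (b c a : 'I_4) : R := 2^-1 * (C b c a - C c a b + C a b c).

Definition frame_riem (b c d a : 'I_4) : R :=
  \sum_e (frame_conn c d e * frame_conn b e a - frame_conn b d e * frame_conn c e a
          - C b c e * frame_conn e d a).

(** The trace runs over the first and last slots, in accordance with R_{ij} = g^{kl} R_{kijl}; in an
    orthonormal frame no inverse metric appears. *)
Definition frame_ric (c d : 'I_4) : R := \sum_a frame_riem a c d a.

Definition frame_scal : R := \sum_a frame_ric a a.

Definition kron (i j : 'I_4) : R := (i == j)%:R.

Definition frame_weyl (i j k l : 'I_4) : R :=
  frame_riem i j k l
  - 2^-1 * (frame_ric i l * kron j k + frame_ric j k * kron i l
            - frame_ric i k * kron j l - frame_ric j l * kron i k)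
  + 6^-1 * frame_scal * (kron i l * kron j k - kron i k * kron j l).

Definition seq4 (w : 'I_4 -> 'I_4 -> 'I_4 -> 'I_4 -> R) (s : seq 'I_4) : R :=
  if s is [:: i; j; k; l] then w i j k l else 0.

(** The connection acts as a derivation, on one slot at a time. For constant components nothing is
    left to differentiate, so the covariant derivative is minus this action. *)
Definition frame_action e t (s : seq 'I_4) : R :=
  \sum_(r < size s) \sum_m frame_conn e (nth ord0 s r) m * t (set_nth ord0 s r m).

Definition frame_nabla t (s : seq 'I_4) : R :=
  if s is e :: s' then - frame_action e t s' else 0.

Definition frame_bach (i j : 'I_4) : R :=
  \sum_k \sum_l frame_nabla (frame_nabla (seq4 frame_weyl)) [:: k; l; k; i; j; l]
  + 2^-1 * \sum_k \sum_l frame_ric k l * frame_weyl k i j l.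

Definition frame_bachmx : 'M[R]_4 := \matrix_(i, j) frame_bach i j.

Lemma frame_action_cons e t b u :
  frame_action e t (b :: u) =
  \sum_m frame_conn e b m * t (m :: u) + frame_action e (fun v => t (b :: v)) u.
Proof. by rewrite /frame_action /= big_ord_recl. Qed.

End FrameTensors.

(** * Passage from coordinate tensors to constant frame components *)

Section Frame.
Context {R : realType}.
Variables (th E : 'rV[R]_4 -> 'M[R]_4) (C : 'I_4 -> 'I_4 -> 'I_4 -> R).
Hypothesis th_poly : polymx th.
Hypothesis E_poly : polymx E.
Hypothesis thE : forall p, th p *m E p = 1%:M.
Hypothesis C_anti : forall b c a, C b c a = - C c b a.
(** The Maurer-Cartan equations for the coframe, evaluated on the coordinate fields. They are the
    link between [th] and the constants [C]. *)
Hypothesis dth : forall i j a p,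
  partial i (fun q => th q j a) p - partial j (fun q => th q i a) p =
  - \sum_b \sum_c C b c a * th p i b * th p j c.

Let g (p : 'rV[R]_4) := th p *m (th p)^T.

Lemma frame_inv p : E p *m th p = 1%:M.
Proof. exact: mulmx1C. Qed.

Lemma frame_ginv p : ginv g p = (E p)^T *m E p.
Proof.
rewrite /ginv /g.
have inv : (th p *m (th p)^T) *m ((E p)^T *m E p) = 1%:M.
  by rewrite -mulmxA (mulmxA (th p)^T) -trmx_mul frame_inv trmx1 mul1mx thE.
by have [u _] := mulmx1_unit inv; rewrite -[RHS](mulKmx u) inv mulmx1.
Qed.

Lemma gE p j l : g p j l = \sum_a th p j a * th p l a.
Proof. by rewrite !mxE; apply: eq_bigr => a _; rewrite mxE. Qed.

Definition frame_connmx b : 'M[R]_4 := \matrix_(c, a) frame_conn C b c a.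

Definition conn_form i p : 'M[R]_4 := \sum_b th p i b *: frame_connmx b.

Lemma conn_formE i p c a : conn_form i p c a = \sum_b th p i b * frame_conn C b c a.
Proof. by rewrite summxE; apply: eq_bigr => b _; rewrite !mxE. Qed.

Definition Gam i p : 'M[R]_4 := \matrix_(j, k) christoffel g k i j p.

Let pd i j a p := partial i (fun q => th q j a) p.

Lemma partial_g i j l p :
  partial i (fun q => g q j l) p =
  \sum_a (pd i j a p * th p l a + th p j a * pd i l a p).
Proof.
rewrite (_ : (fun _ => _) = fun q => \sum_a th q j a * th q l a); last first.
  by apply/funext => q; rewrite gE.
rewrite partial_sum => [|a]; last by apply/polyf_diff/polyfM; exact: th_poly.
by apply: eq_bigr => a _; rewrite partialM //; apply: polyf_diff; exact: th_poly.
Qed.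

(** The change-of-frame law of a connection: write d_j = \sum_a th_j^a E_a and apply nabla_i. As the
    Christoffel symbols come from a formula in the metric, the proof lowers an index and runs
    Koszul's computation. *)
Lemma Gam_frame i p : Gam i p *m th p = dmx i th p + th p *m conn_form i p.
Proof.
pose X := dmx i th p + th p *m conn_form i p.
pose T i j a := \sum_b \sum_c C b c a * th p i b * th p j c.
suff -> : Gam i p = X *m E p by rewrite -mulmxA frame_inv mulmx1.
have low j l : partial i (fun q => g q j l) p + partial j (fun q => g q i l) p
     - partial l (fun q => g q i j) p = 2 * (X *m (th p)^T) j l.
  rewrite !partial_g mxE mulr_sumr -!big_split -sumrB /=.
  have XE a : X j a = pd i j a p + \sum_c \sum_b frame_conn C b c a * th p i b * th p j c.
    rewrite !mxE; congr (_ + _); apply: eq_bigr => c _.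
    by rewrite conn_formE mulr_sumr; apply: eq_bigr => b _; ring.
  (* Exchanging the two indices of a derivative of [th] costs a bracket term [T]. After three
     exchanges the derivatives merge into 2 d_i th_j, and the bracket terms form the combination
     that defines [frame_conn]. *)
  have swap k m a : pd k m a p = pd m k a p - T k m a by rewrite -dth /pd; ring.
  transitivity (\sum_a (2 * pd i j a p * th p l a) + \sum_a (T i j a * th p l a)
     - \sum_a (T i l a * th p j a) - \sum_a (T j l a * th p i a)).
    rewrite -big_split -!sumrB; apply: eq_bigr => a _ /=.
    by rewrite (swap i l) (swap j l) (swap i j); ring.
  transitivity (\sum_a (2 * pd i j a p * th p l a) +
     \sum_a \sum_c \sum_b 2 * frame_conn C b c a * th p i b * th p j c * th p l a); last first.
    rewrite -big_split; apply: eq_bigr => a _ /=.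
    rewrite XE [(th p)^T a l]mxE [(_ + _) * th p l a]mulrDl [RHS]mulrDr mulrA; congr (_ + _).
    rewrite mulr_suml mulr_sumr; apply: eq_bigr => c _.
    by rewrite mulr_suml mulr_sumr; apply: eq_bigr => b _; ring.
  rewrite -!addrA; congr (_ + _).
  have -> : \sum_a T i j a * th p l a =
      \sum_a \sum_c \sum_b C b c a * th p i b * th p j c * th p l a.
    apply: eq_bigr => a _; rewrite /T mulr_suml exchange_big.
    by apply: eq_bigr => b _; rewrite mulr_suml.
  have -> : \sum_a T i l a * th p j a =
      \sum_a \sum_c \sum_b C b a c * th p i b * th p l a * th p j c.
    rewrite exchange_big; apply: eq_bigr => c _; rewrite /T mulr_suml exchange_big /=.
    by apply: eq_bigr => b _; rewrite mulr_suml.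
  have -> : \sum_a T j l a * th p i a =
      \sum_a \sum_c \sum_b C c a b * th p j c * th p l a * th p i b.
    under [RHS]eq_bigr => a _ do rewrite exchange_big /=.
    rewrite exchange_big; apply: eq_bigr => c _; rewrite /T mulr_suml exchange_big /=.
    by apply: eq_bigr => b _; rewrite mulr_suml.
  rewrite -!sumrN -!big_split; apply: eq_bigr => a _ /=.
  rewrite -!sumrN -!big_split; apply: eq_bigr => c _ /=.
  rewrite -!sumrN -!big_split; apply: eq_bigr => b _ /=.
  by rewrite /frame_conn (C_anti b a); field.
have -> : Gam i p = X *m (th p)^T *m (ginv g p)^T.
  apply/matrixP => j k; rewrite !mxE /christoffel.
  rewrite mulr_sumr; apply: eq_bigr => l _; rewrite low [(ginv g p)^T _ _]mxE.
  by field.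
rewrite frame_ginv trmx_mul trmxK -!mulmxA; congr (_ *m _).
by rewrite mulmxA -trmx_mul frame_inv trmx1 mul1mx.
Qed.

Lemma conn_form_poly i : polymx (conn_form i).
Proof.
move=> c a; rewrite (_ : (fun _ => _) = fun p => \sum_b th p i b * frame_conn C b c a).
  by apply: polyf_sum => b; apply: polyfM; [exact: th_poly|exact: polyf_cst].
by apply/funext => p; rewrite conn_formE.
Qed.

Lemma Gam_poly i : polymx (Gam i).
Proof.
rewrite (_ : Gam i = fun p => (dmx i th p + th p *m conn_form i p) *m E p).
  apply: polymxM => //; apply: polymxD; first exact: polymx_dmx.
  by apply: polymxM => //; exact: conn_form_poly.
by apply/funext => p; rewrite -Gam_frame -mulmxA thE mulmx1.
Qed.

Definition riem_form i j p : 'M[R]_4 :=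
  \sum_b \sum_c (th p i b * th p j c) *:
    (frame_connmx c *m frame_connmx b - frame_connmx b *m frame_connmx c
     - \sum_e C b c e *: frame_connmx e).

Definition Rmx i j p : 'M[R]_4 := \matrix_(k, l) riemann_up g l i j k p.

Lemma RmxE i j p :
  Rmx i j p = dmx i (Gam j) p - dmx j (Gam i) p
              + (Gam j p *m Gam i p - Gam i p *m Gam j p).
Proof.
apply/matrixP => k l; rewrite !mxE /riemann_up; congr (_ - _ + _).
- by congr partial; apply/funext => q; rewrite mxE.
- by congr partial; apply/funext => q; rewrite mxE.
- rewrite -sumrB; apply: eq_bigr => m _; rewrite !mxE.
  by rewrite mulrC [X in _ - X]mulrC.
Qed.

Lemma dmx_conn_form i j p :
  dmx i (conn_form j) p = \sum_a pd i j a p *: frame_connmx a.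
Proof.
apply/matrixP => c a; rewrite summxE mxE.
rewrite (_ : (fun _ => _) = fun p => \sum_b th p j b * frame_conn C b c a); last first.
  by apply/funext => q; rewrite conn_formE.
rewrite partial_sum => [|b]; last first.
  by apply/polyf_diff/polyfM; [exact: th_poly|exact: polyf_cst].
apply: eq_bigr => b _; rewrite partialM ?partial_cst ?mulr0 ?addr0 ?mxE //.
  by apply: polyf_diff; exact: th_poly.
Qed.

(** Curvature is tensorial, so the derivatives of [th] in the change-of-frame law must cancel; the
    identity comes from differentiating [Gam_frame] once more. *)
Lemma Rmx_frame i j p : Rmx i j p *m th p = th p *m riem_form i j p.
Proof.
(* On antisymmetrizing in [k] and [l], the second derivative of [th] and the two terms mixing [dmx]
   of [th] with [conn_form] disappear. What remains is [th] times the curvature of [conn_form]. *)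
have key k l : dmx k (Gam l) p *m th p + Gam l p *m Gam k p *m th p =
    dmx k (dmx l th) p + dmx k th p *m conn_form l p + th p *m dmx k (conn_form l) p
    + dmx l th p *m conn_form k p + th p *m (conn_form l p *m conn_form k p).
  have := dmxM k _ _ p (Gam_poly l) th_poly.
  rewrite (_ : (fun _ => _) = fun q => dmx l th q + th q *m conn_form l q); last first.
    by apply/funext => q; rewrite Gam_frame.
  rewrite dmxD; last 2 first.
  - exact: polymx_dmx.
  - by apply: polymxM => //; exact: conn_form_poly.
  rewrite dmxM //; last exact: conn_form_poly.
  move=> H; rewrite -[X in X + _ = _](addrK (Gam l p *m dmx k th p)) -H.
  rewrite -(mulmxA (Gam l p)) Gam_frame mulmxDr (mulmxA (Gam l p)) Gam_frame mulmxDl -mulmxA.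
  rewrite -!addrA; do 3 congr (_ + _).
  by rewrite addKr.
rewrite RmxE mulmxDl !mulmxBl addrACA -opprD [X in X - _]key [X in _ - X]key.
rewrite (dmxC i j) // [X in X + _]addrAC -addrA.
(* [conn_form] is linear in [th] with constant coefficients, so [dth] gives its antisymmetrized
   derivative; this produces the bracket term of [riem_form]. The products appear in reversed order
   because matrices act on rows. *)
have -> : riem_form i j p = dmx i (conn_form j) p - dmx j (conn_form i) p
    + (conn_form j p *m conn_form i p - conn_form i p *m conn_form j p).
  have mulcf k l : conn_form l p *m conn_form k p =
      \sum_b \sum_c (th p k b * th p l c) *: (frame_connmx c *m frame_connmx b).
    rewrite exchange_big mulmx_suml; apply: eq_bigr => c _.
    rewrite mulmx_sumr; apply: eq_bigr => b _.
    by rewrite -scalemxAl -scalemxAr scalerA mulrC.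
  have mulcf' : conn_form i p *m conn_form j p =
      \sum_b \sum_c (th p i b * th p j c) *: (frame_connmx b *m frame_connmx c).
    rewrite mulmx_suml; apply: eq_bigr => b _.
    rewrite mulmx_sumr; apply: eq_bigr => c _.
    by rewrite -scalemxAl -scalemxAr scalerA.
  rewrite mulcf mulcf' -sumrB !dmx_conn_form -sumrB.
  under [X in X + _]eq_bigr => a _ do rewrite -scalerBl /pd dth scaleNr scaler_suml.
  rewrite sumrN addrC exchange_big /= -sumrB /riem_form; apply: eq_bigr => b _.
  under [X in _ - X]eq_bigr => a _ do rewrite scaler_suml.
  rewrite exchange_big -!sumrB; apply: eq_bigr => c _ /=.
  rewrite !scalerBr scaler_sumr; congr (_ - _).
  by apply: eq_bigr => e _; rewrite scalerA; congr (_ *: _); ring.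
rewrite !mulmxDr !mulmxN.
move: (dmx j (dmx i th) p) (th p *m dmx i (conn_form j) p)
  (th p *m dmx j (conn_form i) p) (th p *m (conn_form j p *m conn_form i p))
  (th p *m (conn_form i p *m conn_form j p)) (dmx i th p *m conn_form j p)
  (dmx j th p *m conn_form i p) => a1 a2 a3 a4 a5 a6 a7.
by apply/matrixP => x y; rewrite !mxE; ring.
Qed.

Lemma riemann_frame i j k l p :
  riemann g i j k l p = ev (th p) (seq4 (frame_riem C)) [:: i; j; k; l].
Proof.
have -> : riemann g i j k l p = (Rmx i j p *m th p *m (th p)^T) k l.
  rewrite -mulmxA -/(g p) mxE; apply: eq_bigr => m _; rewrite [Rmx _ _ _ _ _]mxE mulrC.
  by congr (_ * _); rewrite !gE; apply: eq_bigr => a _; rewrite mulrC.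
rewrite Rmx_frame -mulmxA mxE /=.
under eq_bigr => d _ do rewrite mulmx_suml summxE mulr_sumr.
rewrite exchange_big; apply: eq_bigr => b _ /=; rewrite mulr_sumr.
under eq_bigr => d _ do rewrite mulmx_suml summxE mulr_sumr.
rewrite exchange_big; apply: eq_bigr => c _ /=; rewrite !mulr_sumr.
apply: eq_bigr => d _; rewrite -scalemxAl !mxE !mulr_sumr; apply: eq_bigr => a _.
rewrite /frame_riem !mxE summxE.
have -> : \sum_j0 frame_connmx c d j0 * frame_connmx b j0 a -
     \sum_j0 frame_connmx b d j0 * frame_connmx c j0 a -
     \sum_k0 (C b c k0 *: frame_connmx k0) d a =
     \sum_e (frame_conn C c d e * frame_conn C b e a -
             frame_conn C b d e * frame_conn C c e a -
             C b c e * frame_conn C e d a).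
  by rewrite -!sumrB; apply: eq_bigr => e _; rewrite !mxE.
by ring.
Qed.

Lemma contractE p a b :
  \sum_k \sum_l ginv g p k l * (th p k a * th p l b) = (a == b)%:R.
Proof.
have <- : ((th p)^T *m (ginv g p *m th p)) a b = (a == b)%:R.
  by rewrite frame_ginv !mulmxA -trmx_mul frame_inv trmx1 mul1mx frame_inv mxE.
rewrite mxE; apply: eq_bigr => k _; rewrite !mxE mulr_sumr.
by apply: eq_bigr => l _; ring.
Qed.

Lemma frame_contract p (F : 'I_4 -> 'I_4 -> R) :
  \sum_k \sum_l ginv g p k l * (\sum_a th p k a * \sum_b th p l b * F a b) =
  \sum_a F a a.
Proof.
transitivity (\sum_a \sum_b (a == b)%:R * F a b); last first.
  apply: eq_bigr => a _; rewrite (bigD1 a) //= eqxx mul1r big1 ?addr0 // => b.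
  by rewrite eq_sym => /negbTE ->; rewrite mul0r.
under [RHS]eq_bigr => a _.
  under eq_bigr => b _.
    rewrite -(contractE p) mulr_suml; under eq_bigr => k _ do rewrite mulr_suml.
    over.
  rewrite exchange_big /=; under eq_bigr => k _ do rewrite exchange_big /=.
  over.
rewrite [RHS]exchange_big; apply: eq_bigr => k _ /=.
rewrite [RHS]exchange_big; apply: eq_bigr => l _ /=.
rewrite mulr_sumr; apply: eq_bigr => a _ /=.
rewrite !mulr_sumr; apply: eq_bigr => b _ /=.
by ring.
Qed.

(** The contraction pattern shared by both terms of the Bach tensor: first slot with third, second
    with fourth. *)
Lemma frame_contract2 p (F : 'I_4 -> 'I_4 -> 'I_4 -> 'I_4 -> R) :
  \sum_k \sum_l \sum_a \sum_b ginv g p k a * ginv g p l b *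
    (\sum_x th p a x * \sum_y th p b y * \sum_z th p k z * \sum_w th p l w * F x y z w) =
  \sum_x \sum_y F x y x y.
Proof.
transitivity (\sum_l \sum_b ginv g p l b *
    (\sum_w th p l w * \sum_y th p b y * \sum_x F x y x w)); last first.
  by rewrite (frame_contract p (fun w y => \sum_x F x y x w)) exchange_big.
rewrite exchange_big; apply: eq_bigr => l _ /=.
under eq_bigr => k _ do rewrite exchange_big /=.
rewrite exchange_big; apply: eq_bigr => b _ /=.
transitivity (ginv g p l b * \sum_k \sum_a ginv g p k a *
   (\sum_z th p k z * \sum_x th p a x *
      \sum_w th p l w * \sum_y th p b y * F x y z w)).
  rewrite mulr_sumr; apply: eq_bigr => k _.
  rewrite mulr_sumr; apply: eq_bigr => a _.
  rewrite -mulrA mulrCA; congr (_ * (_ * _)).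
  under [RHS]eq_bigr => z _ do rewrite mulr_sumr.
  rewrite [RHS]exchange_big; apply: eq_bigr => x _ /=.
  rewrite mulr_sumr.
  under [RHS]eq_bigr => z _ do rewrite !mulr_sumr.
  under [RHS]eq_bigr => z _ do under eq_bigr => w _ do rewrite !mulr_sumr.
  rewrite [LHS](eq_bigr (fun y => \sum_z \sum_w
     th p k z * (th p a x * (th p l w * (th p b y * F x y z w))))); last first.
    move=> y _; rewrite !mulr_sumr; apply: eq_bigr => z _.
    by rewrite !mulr_sumr; apply: eq_bigr => w _; ring.
  rewrite exchange_big; apply: eq_bigr => z _ /=.
  by rewrite exchange_big.
rewrite frame_contract; congr (_ * _).
rewrite exchange_big; apply: eq_bigr => w _ /=.
rewrite -mulr_sumr; congr (_ * _).
rewrite exchange_big; apply: eq_bigr => y _ /=.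
by rewrite -mulr_sumr.
Qed.

Lemma ricci_frame i j p :
  ricci g i j p = \sum_c th p i c * \sum_d th p j d * frame_ric C c d.
Proof.
pose F b a := \sum_c th p i c * \sum_d th p j d * frame_riem C b c d a.
transitivity (\sum_a F a a); last first.
  rewrite exchange_big; apply: eq_bigr => c _ /=.
  rewrite -mulr_sumr; congr (_ * _).
  by rewrite exchange_big; apply: eq_bigr => d _ /=; rewrite -mulr_sumr.
rewrite -(frame_contract p); apply: eq_bigr => k _; apply: eq_bigr => l _.
congr (_ * _); rewrite riemann_frame /=; apply: eq_bigr => b _; congr (_ * _).
rewrite /F.
under [RHS]eq_bigr => a _ do rewrite mulr_sumr.
rewrite [RHS]exchange_big; apply: eq_bigr => c _ /=.
under [RHS]eq_bigr => a _ do rewrite mulrCA.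
rewrite -mulr_sumr; congr (_ * _).
under [RHS]eq_bigr => a _ do rewrite mulr_sumr.
rewrite [RHS]exchange_big; apply: eq_bigr => d _ /=.
under [RHS]eq_bigr => a _ do rewrite mulrCA.
by rewrite -mulr_sumr.
Qed.

Lemma scalar_curvature_frame p : scalar_curvature g p = frame_scal C.
Proof.
rewrite -[RHS](frame_contract p); apply: eq_bigr => k _; apply: eq_bigr => l _.
by rewrite ricci_frame.
Qed.

(** The correction terms of the Weyl tensor pair the indices as il, jk or as ik, jl, and must be
    brought to the order i, j, k, l before they can be added under a single [ev]. *)
Lemma ev_il_jk r s i j k l p :
  (\sum_b th p i b * \sum_a th p l a * r b a) * (\sum_c th p j c * \sum_d th p k d * s c d) =
  ev (th p) (seq4 (fun b c d a => r b a * s c d)) [:: i; j; k; l].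
Proof.
pose t := seq4 (fun b c d a => r b a * s c d).
rewrite mulr_suml; apply: eq_bigr => b _; rewrite -mulrA; congr (_ * _).
rewrite [RHS](ev_pull (th p) (fun u => t (b :: u)) [:: j; k] l [::]) mulr_suml; apply: eq_bigr => a _.
rewrite -mulrA; congr (_ * _); rewrite mulr_sumr; apply: eq_bigr => c _.
rewrite mulrCA; congr (_ * _); rewrite mulr_sumr; apply: eq_bigr => d _.
by rewrite mulrCA.
Qed.

Lemma ev_ik_jl r s i j k l p :
  (\sum_b th p i b * \sum_d th p k d * r b d) * (\sum_c th p j c * \sum_a th p l a * s c a) =
  ev (th p) (seq4 (fun b c d a => r b d * s c a)) [:: i; j; k; l].
Proof.
pose t := seq4 (fun b c d a => r b d * s c a).
rewrite mulr_suml; apply: eq_bigr => b _; rewrite -mulrA; congr (_ * _).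
rewrite [RHS](ev_pull (th p) (fun u => t (b :: u)) [:: j] k [:: l]) mulr_suml; apply: eq_bigr => d _.
rewrite -mulrA; congr (_ * _); rewrite mulr_sumr; apply: eq_bigr => c _.
rewrite mulrCA; congr (_ * _); rewrite mulr_sumr; apply: eq_bigr => a _.
by rewrite mulrCA.
Qed.

Lemma g_frame i j p :
  g p i j = \sum_a th p i a * \sum_b th p j b * kron a b.
Proof.
rewrite gE; apply: eq_bigr => a _; congr (_ * _).
rewrite (bigD1 a) //= /kron eqxx mulr1 big1 ?addr0 // => b.
by rewrite eq_sym => /negbTE ->; rewrite mulr0.
Qed.

Lemma weyl_frame i j k l p :
  weyl g i j k l p = ev (th p) (seq4 (frame_weyl C)) [:: i; j; k; l].
Proof.
rewrite /weyl riemann_frame scalar_curvature_frame !ricci_frame !g_frame.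
rewrite [X in _ - _ * (_ + X - _ - _)]mulrC [X in _ - _ * (_ + _ - _ - X)]mulrC.
rewrite !(ev_il_jk _ _ i j k l) !(ev_ik_jl _ _ i j k l).
rewrite -!evN -!evD -!evZ -!evN -!evD; apply: eq_ev => -[|a[|b[|c[|d[|x u]]]]] //= _.
by rewrite /frame_weyl; ring.
Qed.

(** All lengths are covered because [nabla_frame] asks for agreement on every index list; away from
    length 4 both sides vanish. *)
Lemma weyl_tensor_frame s p :
  weyl_tensor g s p = ev (th p) (seq4 (frame_weyl C)) s.
Proof.
have ev_long t (s' : seq 'I_4) : (forall u, size u = size s' -> t u = 0) ->
    ev (th p) t s' = 0.
  by move=> t0; rewrite -[RHS](ev0 (th p) s'); exact: eq_ev.
case: s => [|i[|j[|k[|l[|m u]]]]]; try by rewrite ev_long // => -[|a[|b[|c[|d[|x v]]]]].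
exact: weyl_frame.
Qed.

Lemma ev_polyf t s : polyf (fun p => ev (th p) t s).
Proof.
elim: s t => [|i s IH] t /=; first exact: polyf_cst.
by apply: polyf_sum => a; apply: polyfM => //; exact: th_poly.
Qed.

Lemma covariant_ev t s a p :
  partial a (fun q => ev (th q) t s) p
  - \sum_(r < size s) \sum_m
      christoffel g m a (nth ord0 s r) p * ev (th p) t (set_nth ord0 s r m)
  = - \sum_e th p a e * ev (th p) (frame_action C e t) s.
Proof.
elim: s t => [|i s IH] t /=.
  rewrite partial_cst big_ord0 subr0 big1 ?oppr0 // => e _.
  by rewrite /frame_action /= big_ord0 mulr0.
rewrite big_ord_recl /= partial_sum => [|b]; last first.
  by apply/polyf_diff/polyfM; [exact: th_poly|exact: ev_polyf].
rewrite (eq_bigr (fun b => pd a i b p * ev (th p) (fun u => t (b :: u)) s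
   + th p i b * partial a (fun q => ev (th q) (fun u => t (b :: u)) s) p)); last first.
  by move=> b _; rewrite partialM //; apply: polyf_diff; [exact: th_poly|exact: ev_polyf].
have -> : \sum_m christoffel g m a i p *
     (\sum_b th p m b * ev (th p) (fun u => t (b :: u)) s) =
   \sum_b (Gam a p *m th p) i b * ev (th p) (fun u => t (b :: u)) s.
  under eq_bigr => m _ do rewrite mulr_sumr.
  rewrite exchange_big; apply: eq_bigr => b _ /=; rewrite mxE mulr_suml.
  by apply: eq_bigr => m _; rewrite !mxE mulrA.
rewrite Gam_frame big_split opprD /=.
have -> : \sum_(r < size s) \sum_m christoffel g m a (nth ord0 s r) p *
     (\sum_b th p i b * ev (th p) (fun u => t (b :: u)) (set_nth ord0 s r m)) =
   \sum_b th p i b * \sum_(r < size s) \sum_m christoffel g m a (nth ord0 s r) p *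
       ev (th p) (fun u => t (b :: u)) (set_nth ord0 s r m).
  under [RHS]eq_bigr => b _ do rewrite mulr_sumr.
  rewrite [RHS]exchange_big; apply: eq_bigr => r _ /=.
  under [RHS]eq_bigr => b _ do rewrite mulr_sumr.
  rewrite [RHS]exchange_big; apply: eq_bigr => m _ /=.
  by rewrite mulr_sumr; apply: eq_bigr => b _; rewrite mulrCA.
rewrite addrACA -!sumrB.
under [X in _ + X = _]eq_bigr => b _ do rewrite -mulrBr IH mulrN.
rewrite sumrN.
(* The derivative of the head factor [th] cancels here, before the remaining sums are matched with
   [frame_action_cons]. *)
rewrite [X in X + _ = _](eq_bigr (fun b => - ((th p *m conn_form a p) i b *
     ev (th p) (fun u => t (b :: u)) s))); last first.
  move=> b _; rewrite [(dmx _ _ _ + _) i b]mxE [dmx a th p i b]mxE mulrDl opprD.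
  by rewrite addrA subrr sub0r.
rewrite sumrN -opprD; congr (- _).
under [RHS]eq_bigr => e _.
  rewrite (eq_bigr (fun b => \sum_m th p i b * (frame_conn C e b m *
      ev (th p) (fun u => t (m :: u)) s) +
      th p i b * ev (th p) (frame_action C e (fun u => t (b :: u))) s)); last first.
    move=> b _; rewrite -mulr_sumr -mulrDr; congr (_ * _).
    rewrite -[in RHS](eq_bigr _ (fun m _ => evZ _ _ _ _)) -ev_sum -evD.
    by apply: eq_ev => u _; rewrite frame_action_cons.
  rewrite big_split mulrDr; over.
rewrite big_split; congr (_ + _); last first.
  under [RHS]eq_bigr => e _ do rewrite mulr_sumr.
  rewrite [RHS]exchange_big; apply: eq_bigr => b _; rewrite mulr_sumr.
  by apply: eq_bigr => e _; rewrite mulrCA.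
under [RHS]eq_bigr => e _.
  rewrite exchange_big mulr_sumr /=; under eq_bigr => m _ do rewrite mulr_sumr.
  over.
rewrite [RHS]exchange_big; apply: eq_bigr => m _ /=.
rewrite [RHS]exchange_big mxE mulr_suml; apply: eq_bigr => b _ /=.
rewrite conn_formE mulr_sumr mulr_suml; apply: eq_bigr => e _.
by ring.
Qed.

(** The output again has constant frame components, so the lemma can be iterated to reach second
    covariant derivatives. *)
Lemma nabla_frame (T : tensor_field) t s p :
  (forall s q, T s q = ev (th q) t s) ->
  nabla g T s p = ev (th p) (frame_nabla C t) s.
Proof.
move=> TE; case: s => [|a s] //=.
rewrite (_ : T s = fun q => ev (th q) t s); last by apply/funext => q.
rewrite (eq_bigr (fun r : 'I_(size s) => \sum_m christoffel g m a (nth ord0 s r) p *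
   ev (th p) t (set_nth ord0 s r m))); last first.
  by move=> r _; apply: eq_bigr => m _; rewrite TE.
rewrite covariant_ev -sumrN; apply: eq_bigr => e _.
by rewrite -mulrN -evN.
Qed.

Theorem bach_frame i j p :
  bach g i j p = (th p *m frame_bachmx C *m (th p)^T) i j.
Proof.
have -> : (th p *m frame_bachmx C *m (th p)^T) i j =
   \sum_c th p i c * \sum_d th p j d * frame_bach C c d.
  rewrite -mulmxA mxE; apply: eq_bigr => c _; congr (_ * _); rewrite mxE.
  by apply: eq_bigr => d _; rewrite !mxE mulrC.
pose t := frame_nabla C (frame_nabla C (seq4 (frame_weyl C))).
(* The contracted indices of the second derivative sit in slots 1, 2, 3 and 6, with the free pair in
   between. [F] brings them to the front, reinserting [w] after the two free slots. *)
pose F x y z w := ev (th p) (fun u =>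
   t [:: x, y, z & take 2 u ++ w :: drop 2 u]) [:: i; j].
pose G x y z w := ev (th p) (fun u => if u is [:: b; c] then
   frame_ric C x y * frame_weyl C z b c w else 0) [:: i; j].
transitivity (\sum_x \sum_y F x y x y + 2^-1 * \sum_x \sum_y G x y x y); last first.
  have sum2 (H : 'I_4 -> 'I_4 -> seq 'I_4 -> R) : \sum_x \sum_y ev (th p) (H x y) [:: i; j] =
     ev (th p) (fun u => \sum_x \sum_y H x y u) [:: i; j].
    by rewrite ev_sum; apply: eq_bigr => x _; rewrite ev_sum.
  by rewrite !sum2 -evZ -evD.
rewrite -!(frame_contract2 p); congr (_ + _ * _).
- apply: eq_bigr => k _; apply: eq_bigr => l _; apply: eq_bigr => a _.
  apply: eq_bigr => b _; congr (_ * _).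
  rewrite (nabla_frame _ (frame_nabla C (seq4 (frame_weyl C)))); last first.
    by move=> s q; apply: nabla_frame; exact: weyl_tensor_frame.
  apply: eq_bigr => x _; congr (_ * _); apply: eq_bigr => y _; congr (_ * _).
  apply: eq_bigr => z _; congr (_ * _).
  exact: (ev_pull (th p) (fun u => t [:: x, y, z & u]) [:: i; j] l [::]).
- apply: eq_bigr => k _; apply: eq_bigr => l _.
  rewrite mulr_suml; apply: eq_bigr => a _.
  rewrite mulr_suml; apply: eq_bigr => b _.
  rewrite -mulrA; congr (_ * _); rewrite weyl_frame ricci_frame.
  rewrite mulr_suml; apply: eq_bigr => x _; rewrite -mulrA; congr (_ * _).
  rewrite mulr_suml; apply: eq_bigr => y _; rewrite -mulrA; congr (_ * _).
  rewrite mulr_sumr; apply: eq_bigr => z _; rewrite mulrCA; congr (_ * _).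
  pose W u := seq4 (frame_weyl C) (z :: u).
  rewrite (_ : \sum_a0 _ = ev (th p) W ([:: i; j] ++ [:: l])) // ev_pull.
  rewrite mulr_sumr; apply: eq_bigr => w _.
  by rewrite mulrCA -evZ.
Qed.

Lemma laplacian_scalar_curvature_frame p : laplacian g (scalar_curvature g) p = 0.
Proof.
rewrite (_ : scalar_curvature g = fun=> frame_scal C); last first.
  by apply/funext => q; exact: scalar_curvature_frame.
have pc i : partial i (fun=> frame_scal C) = (fun=> 0) :> ('rV[R]_4 -> R).
  by apply/funext => q; exact: partial_cst.
rewrite /laplacian big1 // => i _; rewrite big1 // => j _.
rewrite /hessian pc partial_cst big1 ?subr0 ?mulr0 // => k _.
by rewrite pc mulr0.
Qed.

End Frame.

(** * The Bach tensor of the filiform brackets *)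

Section FiliformBachTensor.
Import BinInt Ring_theory Ring_polynom InitialRing.
Context {R : realType}.

Definition filiform_const_nat {T : Type} (zero : T) (opp : T -> T) (a b c : T)
    (i j k : nat) : T :=
  match i, j, k with
  | 0, 1, 2 => a | 1, 0, 2 => opp a
  | 0, 1, 3 => b | 1, 0, 3 => opp b
  | 0, 2, 3 => c | 2, 0, 3 => opp c
  | _, _, _ => zero
  end%N.

Definition filiform_const (a b c : R) (i j k : 'I_4) : R :=
  filiform_const_nat 0 -%R a b c i j k.

(* A copy over Z[a, b, c] of the formulas for the frame components of the Bach
   tensor, with denominators cleared, that the kernel can evaluate. *)
Definition zpoly := Pol Z.
Definition padd : zpoly -> zpoly -> zpoly := Padd 0%Z Z.add Z.eqb.
Definition pmul : zpoly -> zpoly -> zpoly := Pmul 0%Z 1%Z Z.add Z.mul Z.eqb.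
Definition popp : zpoly -> zpoly := Popp Z.opp.
Definition pvar (n : positive) : zpoly := mk_X 0%Z 1%Z n.
Definition psum (f : nat -> zpoly) : zpoly :=
  padd (f 0%N) (padd (f 1%N) (padd (f 2%N) (f 3%N))).
Definition pint (n : Z) : zpoly := Pc n.
Definition pzero : zpoly := pint 0.
(** Evaluation is call-by-value, so the second factor is delayed: a vanishing connection or Ricci
    coefficient then prunes the whole subsum below it. *)
Definition pmul0 (x : zpoly) (y : unit -> zpoly) : zpoly :=
  if x is Pc Z0 then pzero else pmul x (y tt).
Definition pkron (i j : nat) : zpoly := if i == j then pint 1 else pint 0.

Definition pC := filiform_const_nat pzero popp (pvar 1) (pvar 2) (pvar 3).
(** From here on the reflected quantities are integer multiples of the frame ones: 2 for the
    connection, 4 for the Riemann, Ricci and scalar curvatures, 24 for Weyl, 48 and 96 for its first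
    and second derivatives, 192 for Bach. The integer constants in the formulas below compensate for
    these factors. *)
Definition pconn b c a := padd (pC b c a) (padd (popp (pC c a b)) (pC a b c)).
Definition priem b c d a := psum (fun e =>
  padd (pmul (pconn c d e) (pconn b e a))
  (padd (popp (pmul (pconn b d e) (pconn c e a)))
        (popp (pmul (pint 2) (pmul (pC b c e) (pconn e d a)))))).
Definition pric c d := psum (fun a => priem a c d a).
Definition pscal := psum (fun a => pric a a).
Definition pweyl i j k l :=
  padd (pmul (pint 6) (priem i j k l))
  (padd (pmul (pint (-3))
     (padd (pmul0 (pkron j k) (fun=> pric i l))
     (padd (pmul0 (pkron i l) (fun=> pric j k))
     (padd (popp (pmul0 (pkron j l) (fun=> pric i k)))
           (popp (pmul0 (pkron i k) (fun=> pric j l)))))))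
   (pmul pscal (padd (pmul (pkron i l) (pkron j k))
                     (popp (pmul (pkron i k) (pkron j l)))))).
Definition pnabla4 w e i j k l := popp (psum (fun m =>
  padd (pmul0 (pconn e i m) (fun=> w m j k l))
  (padd (pmul0 (pconn e j m) (fun=> w i m k l))
  (padd (pmul0 (pconn e k m) (fun=> w i j m l))
        (pmul0 (pconn e l m) (fun=> w i j k m)))))).
Definition pnabla5 w e h i j k l := popp (psum (fun m =>
  padd (pmul0 (pconn e h m) (fun=> w m i j k l))
  (padd (pmul0 (pconn e i m) (fun=> w h m j k l))
  (padd (pmul0 (pconn e j m) (fun=> w h i m k l))
  (padd (pmul0 (pconn e k m) (fun=> w h i j m l))
        (pmul0 (pconn e l m) (fun=> w h i j k m))))))).
Definition pbach i j :=
  padd (pmul (pint 2)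
         (psum (fun k => psum (fun l => pnabla5 (pnabla4 pweyl) k l k i j l))))
       (psum (fun k => psum (fun l => pmul0 (pric k l) (fun=> pweyl k i j l)))).

Variables a b c : R.

Definition zval : Z -> R := gen_phiZ 0 1 +%R *%R -%R.
Definition pval : zpoly -> R := Pphi 0 +%R *%R zval [:: a; b; c].

Lemma real_ring_theory : ring_theory (0 : R) 1 +%R *%R (fun x y => x - y) -%R eq.
Proof.
split=> //; [exact: add0r|exact: addrC|exact: addrA|exact: mul1r|exact: mulrC
  |exact: mulrA|exact: mulrDl|exact: subrr].
Qed.

Lemma real_ring_ext : ring_eq_ext +%R *%R -%R (@eq R).
Proof. by split=> [x y -> x' y' ->|x y -> x' y' ->|x y ->]. Qed.

Definition real_almost_ring := Rth_ARth (Eqsth R) real_ring_ext real_ring_theory.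

Lemma zval_morph : ring_morph (0 : R) 1 +%R *%R (fun x y => x - y) -%R eq
  0%Z 1%Z Z.add Z.mul Z.sub Z.opp Z.eqb zval.
Proof.
have [m0 m1 mD mB mM mN me] := gen_phiZ_morph (Eqsth R) real_ring_ext real_ring_theory.
by split=> // x y /Z.eqb_eq ->.
Qed.

Lemma pvalD x y : pval (padd x y) = pval x + pval y.
Proof. exact: (Padd_ok (Eqsth R) real_ring_ext real_almost_ring zval_morph). Qed.

Lemma pvalM x y : pval (pmul x y) = pval x * pval y.
Proof. exact: (Pmul_ok (Eqsth R) real_ring_ext real_almost_ring zval_morph). Qed.

Lemma pvalN x : pval (popp x) = - pval x.
Proof. exact: (Popp_ok (Eqsth R) real_ring_ext real_almost_ring zval_morph). Qed.

Lemma pvalX n : pval (pvar n) = BinList.nth 0 n [:: a; b; c].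
Proof. exact: (esym (mkX_ok (Eqsth R) real_ring_ext real_almost_ring zval_morph n [:: a; b; c])). Qed.

Lemma pvalM0 x y : pval (pmul0 x y) = pval x * pval (y tt).
Proof.
rewrite -pvalM; case: x => [[|n|n]|n x|x n x'] //.
by rewrite pvalM /pval /= mul0r.
Qed.

Lemma pval_eq x y : Peq Z.eqb x y -> pval x = pval y.
Proof. by move=> /(Peq_ok (Eqsth R) real_ring_ext zval_morph); apply. Qed.

Lemma pval_sum f : pval (psum f) = \sum_(i < 4) pval (f i).
Proof. by rewrite !pvalD !big_ord_recl big_ord0 addr0. Qed.

Local Notation C := (filiform_const a b c).

Lemma pvalC (i j k : 'I_4) : pval (pC i j k) = C i j k.
Proof.
rewrite /pC /filiform_const.
move: (nat_of_ord i) (nat_of_ord j) (nat_of_ord k).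
move=> {i j k} [|[|[|i]]] [|[|[|j]]] [|[|[|[|k]]]];
  first [exact: pvalX | exact: etrans (pvalN _) (congr1 -%R (pvalX _)) | by []].
Qed.

Lemma pval_conn (i j k : 'I_4) : frame_conn C i j k = 2^-1 * pval (pconn i j k).
Proof. by rewrite !pvalD pvalN !pvalC addrA. Qed.

Lemma pval_riem (i j k l : 'I_4) : frame_riem C i j k l = 4^-1 * pval (priem i j k l).
Proof.
rewrite pval_sum mulr_sumr; apply: eq_bigr => e _.
rewrite !pvalD !pvalN !pvalM !pval_conn pvalC.
by rewrite [pval (pint 2)](_ : _ = 2) //; field.
Qed.

Lemma pval_ric (i j : 'I_4) : frame_ric C i j = 4^-1 * pval (pric i j).
Proof. by rewrite pval_sum mulr_sumr; apply: eq_bigr => e _; rewrite pval_riem. Qed.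

Lemma pval_scal : frame_scal C = 4^-1 * pval pscal.
Proof. by rewrite pval_sum mulr_sumr; apply: eq_bigr => e _; rewrite pval_ric. Qed.

Lemma pval_kron (i j : 'I_4) : kron i j = pval (pkron i j) :> R.
Proof. by rewrite /kron /pkron -val_eqE; case: eqP. Qed.

Lemma pval_weyl (i j k l : 'I_4) : frame_weyl C i j k l = 24^-1 * pval (pweyl i j k l).
Proof.
rewrite /frame_weyl !pval_kron pval_scal !pval_ric pval_riem.
rewrite /pweyl.
move: pscal (priem i j k l) (pric i l) (pric j k) (pric i k) (pric j l)
  (pkron j k) (pkron i l) (pkron j l) (pkron i k) => x1 x2 x3 x4 x5 x6 x7 x8 x9 x10.
rewrite 2!pvalD !pvalM !(pvalD, pvalN, pvalM) !pvalM0.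
have -> : pval (pint 6) = 6 by rewrite /pval /=; ring.
have -> : pval (pint (-3)) = -3 by rewrite /pval /=; ring.
by field.
Qed.

Lemma pval_nabla4 (e i j k l : 'I_4) :
  frame_nabla C (seq4 (frame_weyl C)) [:: e; i; j; k; l] =
  48^-1 * pval (pnabla4 pweyl e i j k l).
Proof.
rewrite pvalN pval_sum /frame_nabla !frame_action_cons.
rewrite [frame_action _ _ _ [::]]big_ord0 addr0 -!big_split mulrN mulr_sumr.
congr (- _); apply: eq_bigr => m _ /=.
by rewrite !pvalD !pvalM0 !pval_conn !pval_weyl; field.
Qed.

Lemma pval_nabla5 (e h i j k l : 'I_4) :
  frame_nabla C (frame_nabla C (seq4 (frame_weyl C))) [:: e; h; i; j; k; l] =
  96^-1 * pval (pnabla5 (pnabla4 pweyl) e h i j k l).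
Proof.
rewrite pvalN pval_sum [LHS]/frame_nabla !frame_action_cons.
rewrite [frame_action _ _ _ [::]]big_ord0 addr0 -!big_split mulrN mulr_sumr.
congr (- _); apply: eq_bigr => m _.
by rewrite !pvalD !pvalM0 !pval_conn !pval_nabla4 [LHS]/=; field.
Qed.

Lemma pval_bach (i j : 'I_4) : frame_bach C i j = 192^-1 * pval (pbach i j).
Proof.
rewrite pvalD pvalM !pval_sum.
have -> : pval (pint 2) = 2 by rewrite /pval /=; ring.
rewrite mulrDr; congr (_ + _); rewrite !mulr_sumr; apply: eq_bigr => k _.
  by rewrite pval_sum !mulr_sumr; apply: eq_bigr => l _; rewrite pval_nabla5; field.
rewrite pval_sum !mulr_sumr; apply: eq_bigr => l _.
by rewrite pvalM0 pval_ric pval_weyl; field.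
Qed.

(** The entries are homogeneous of degree 4 and the trace is zero, as for any Bach tensor in
    dimension 4. Every off-diagonal entry carries a factor b, which is what the uniqueness argument
    exploits. *)
Definition filiform_bachmx_nat (i j : nat) : R :=
  match i, j with
  | 0, 0 => a^+4 / 2 + a^+2 * b^+2 + b^+4 / 2 + b^+2 * c^+2 + c^+4 / 2
            - a^+2 * c^+2 / 8
  | 1, 1 => a^+4 / 2 + a^+2 * b^+2 + b^+4 / 2 + b^+2 * c^+2 / 3
            - a^+2 * c^+2 / 24 - c^+4 / 6
  | 2, 2 => a^+2 * c^+2 / 24 - 5 * a^+4 / 6 - a^+2 * b^+2 + b^+2 * c^+2 / 3
            + c^+4 / 2 - b^+4 / 6
  | 3, 3 => a^+2 * c^+2 / 8 - 5 * b^+4 / 6 - a^+2 * b^+2 - 5 * (b^+2 * c^+2) / 3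
            - 5 * c^+4 / 6 - a^+4 / 6
  | 1, 2 | 2, 1 => 2 / 3 * (b * c * (a^+2 + b^+2 + c^+2))
  | 2, 3 | 3, 2 => - (2 / 3 * (a * b * (a^+2 + b^+2 + c^+2)))
  | _, _ => 0
  end%N.

Theorem filiform_bach (i j : 'I_4) :
  frame_bachmx (filiform_const a b c) i j = filiform_bachmx_nat i j.
Proof.
rewrite mxE pval_bach.
case: i j => [[|[|[|[|i]]]] //= _] [[|[|[|[|j]]]] //= _];
(* For each of the 16 entries the normal form [y] is computed first, then certified by the boolean
   test [Peq]; only the small polynomial [y] is interpreted in the reals. *)
match goal with |- context [pval ?x] =>
  let y := eval vm_compute in x in
  have /pval_eq -> : Peq Z.eqb x y by vm_compute
end; rewrite /pval;
cbv [Pphi pow_pos zval gen_phiZ gen_phiPOS gen_phiPOS1 List.hd List.tl BinList.jump];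
by field.
Qed.

End FiliformBachTensor.

(** * The left-invariant coframe of a filiform bracket *)

Local Notation o0 := (@Ordinal 4 0 isT).
Local Notation o1 := (@Ordinal 4 1 isT).
Local Notation o2 := (@Ordinal 4 2 isT).
Local Notation o3 := (@Ordinal 4 3 isT).

Lemma ord4P (P : 'I_4 -> Prop) : P o0 -> P o1 -> P o2 -> P o3 -> forall i, P i.
Proof.
move=> P0 P1 P2 P3 [[|[|[|[|i]]]] Hi] //.
- by rewrite (bool_irrelevance Hi isT).
- by rewrite (bool_irrelevance Hi isT).
- by rewrite (bool_irrelevance Hi isT).
- by rewrite (bool_irrelevance Hi isT).
Qed.

Lemma sum4E (V : nmodType) (F : 'I_4 -> V) :
  \sum_i F i = F o0 + (F o1 + (F o2 + F o3)).
Proof.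
rewrite !big_ord_recl big_ord0 addr0.
by congr (F _ + (F _ + (F _ + F _))); apply: val_inj.
Qed.

Section FiliformFrame.
Context {R : realType}.
Variables (a b c : R) (K : 'M[R]_4).
Hypothesis KKT : K *m K^T = 1%:M.
Implicit Types (x y p q : 'rV[R]_4).

Definition filiform x y : 'rV[R]_4 := \row_k
  match nat_of_ord k with
  | 2 => (a * (x 0 o0 * y 0 o1 - x 0 o1 * y 0 o0))%R
  | 3 => (b * (x 0 o0 * y 0 o1 - x 0 o1 * y 0 o0)
          + c * (x 0 o0 * y 0 o2 - x 0 o2 * y 0 o0))%R
  | _ => 0%R
  end%N.

Definition rot_bracket (nu : 'rV[R]_4 -> 'rV[R]_4 -> 'rV[R]_4) x y : 'rV[R]_4 :=
  nu (x *m K^T) (y *m K^T) *m K.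

Lemma KTK : K^T *m K = 1%:M.
Proof. exact: mulmx1C. Qed.

(* The rows of 1 - ad / 2 + ad ^ 2 / 6, the differential at p of the left
   translation by - p. *)
Definition coframe_pexp (i j : nat) : pexp :=
  match i, j with
  | 0, 0 | 1, 1 | 2, 2 | 3, 3 => Cst 1
  | 0, 2 => Mul (Cst (a / 2)) (Var o1)
  | 0, 3 => Add (Add (Mul (Cst (b / 2)) (Var o1)) (Mul (Cst (c / 2)) (Var o2)))
                (Mul (Cst (- (a * c / 6))) (Mul (Var o0) (Var o1)))
  | 1, 2 => Mul (Cst (- (a / 2))) (Var o0)
  | 1, 3 => Add (Mul (Cst (- (b / 2))) (Var o0))
                (Mul (Cst (a * c / 6)) (Mul (Var o0) (Var o0)))
  | 2, 3 => Mul (Cst (- (c / 2))) (Var o0)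
  | _, _ => Cst 0
  end%N.

Definition coframe p : 'M[R]_4 := \matrix_(i, j) evalp (coframe_pexp i j) p.

(** The rows of 1 + ad / 2 + ad ^ 2 / 12, which inverts 1 - ad / 2 + ad ^ 2 / 6 because ad ^ 3 =
    0. *)
Definition frame_pexp (i j : nat) : pexp :=
  match i, j with
  | 0, 0 | 1, 1 | 2, 2 | 3, 3 => Cst 1
  | 0, 2 => Mul (Cst (- (a / 2))) (Var o1)
  | 0, 3 => Add (Add (Mul (Cst (- (b / 2))) (Var o1)) (Mul (Cst (- (c / 2))) (Var o2)))
                (Mul (Cst (- (a * c / 12))) (Mul (Var o0) (Var o1)))
  | 1, 2 => Mul (Cst (a / 2)) (Var o0)
  | 1, 3 => Add (Mul (Cst (b / 2)) (Var o0))
                (Mul (Cst (a * c / 12)) (Mul (Var o0) (Var o0)))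
  | 2, 3 => Mul (Cst (c / 2)) (Var o0)
  | _, _ => Cst 0
  end%N.

Definition frame p : 'M[R]_4 := \matrix_(i, j) evalp (frame_pexp i j) p.

Lemma coframe_frame p : coframe p *m frame p = 1%:M.
Proof.
apply/matrixP => i j; rewrite !mxE sum4E !mxE.
by elim/ord4P: i; elim/ord4P: j => /=; field.
Qed.

Definition group_pexp q (k : nat) : pexp :=
  let D := Add (Mul (Cst (q 0 o0)) (Var o1)) (Mul (Cst (- q 0 o1)) (Var o0)) in
  let D' := Add (Mul (Cst (q 0 o0)) (Var o2)) (Mul (Cst (- q 0 o2)) (Var o0)) in
  match k with
  | 0 => Add (Cst (q 0%R o0)) (Var o0)
  | 1 => Add (Cst (q 0%R o1)) (Var o1)
  | 2 => Add (Add (Cst (q 0%R o2)) (Var o2)) (Mul (Cst (a / 2)%R) D)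
  | _ => Add (Add (Add (Cst (q 0%R o3)) (Var o3))
                  (Add (Mul (Cst (b / 2)%R) D) (Mul (Cst (c / 2)%R) D')))
             (Mul (Mul (Cst (a * c / 12)%R) D)
                  (Add (Cst (q 0%R o0)) (Mul (Cst (-1)%R) (Var o0))))
  end%N.

Lemma group_mul_filiform q y (k : 'I_4) :
  group_mul filiform q y 0 k = evalp (group_pexp q k) y.
Proof. by rewrite !mxE; elim/ord4P: k => /=; rewrite ?mxE /=; field. Qed.

Lemma deriv_group_pexp p (i j : 'I_4) :
  evalp (deriv_pexp i (group_pexp (- p) j)) p = coframe p i j.
Proof.
by rewrite mxE; elim/ord4P: i; elim/ord4P: j => /=; rewrite ?mxE /=; field.
Qed.

Lemma group_mul_rot q y :
  group_mul (rot_bracket filiform) q y =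
  group_mul filiform (q *m K^T) (y *m K^T) *m K.
Proof.
have KKv (v : 'rV[R]_4) : v *m K *m K^T = v by rewrite -mulmxA KKT mulmx1.
have KKw (v : 'rV[R]_4) : v *m K^T *m K = v by rewrite -mulmxA KTK mulmx1.
rewrite /group_mul /rot_bracket !KKv.
by rewrite !(mulmxDl, mulmxBl, mulNmx) -!scalemxAl !KKw.
Qed.

Definition coframe_rot p : 'M[R]_4 := K^T *m coframe (p *m K^T).

Definition frame_rot p : 'M[R]_4 := frame (p *m K^T) *m K.

(** The Jacobian of the translation is [coframe_rot p *m K]. The orthogonal factor [K] drops out of
    the metric, and discarding it is what keeps the structure constants in filiform form. *)
Lemma left_invariant_metric_rot :
  left_invariant_metric (rot_bracket filiform) =
  fun p => coframe_rot p *m (coframe_rot p)^T.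
Proof.
apply/funext => p; rewrite /left_invariant_metric.
suff -> : 'J (group_mul (rot_bracket filiform) (- p)) p = coframe_rot p *m K.
  by rewrite trmx_mul -mulmxA (mulmxA K) KKT mul1mx.
have comp k : (fun y => group_mul (rot_bracket filiform) (- p) y 0 k) =
   fun y => \sum_(l < 4) evalp (group_pexp (- p *m K^T) l) (y *m K^T) * K l k.
  apply/funext => y; rewrite group_mul_rot mxE.
  by apply: eq_bigr => l _; rewrite group_mul_filiform.
have pol (l : 'I_4) : polyf (fun y => evalp (group_pexp (- p *m K^T) l) (y *m K^T)).
  by apply: polyf_comp_lin; exists (group_pexp (- p *m K^T) l).
apply/matrixP => i j; rewrite jacobian_polyf => [|k]; last first.
  by rewrite comp; apply: polyf_sum => l; apply: polyfM; [exact: pol|exact: polyf_cst].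
rewrite comp partial_sum => [|l]; last first.
  by apply: polyf_diff; apply: polyfM; [exact: pol|exact: polyf_cst].
rewrite mxE; apply: eq_bigr => l _; rewrite partialM; last 2 first.
- exact/polyf_diff/pol.
- exact/polyf_diff/polyf_cst.
rewrite partial_cst mulr0 addr0; congr (_ * _).
rewrite partial_comp_lin; last by exists (group_pexp (- p *m K^T) l).
rewrite mxE; apply: eq_bigr => m _.
by rewrite partial_evalp mulNmx deriv_group_pexp.
Qed.

Lemma coframe_poly : polymx coframe.
Proof.
move=> i j; exists (coframe_pexp i j); apply/funext => p; exact: mxE.
Qed.

Lemma frame_poly : polymx frame.
Proof. by move=> i j; exists (frame_pexp i j); apply/funext => p; exact: mxE. Qed.

Lemma polymx_comp_lin (F : 'rV[R]_4 -> 'M[R]_4) (M : 'M[R]_4) :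
  polymx F -> polymx (fun p => F (p *m M)).
Proof. by move=> PF i j; exact: (polyf_comp_lin (fun p => F p i j)). Qed.

Lemma coframe_rot_poly : polymx coframe_rot.
Proof.
apply: (polymxM (fun=> K^T)); first exact: polymx_cst.
by apply: polymx_comp_lin; exact: coframe_poly.
Qed.

Lemma frame_rot_poly : polymx frame_rot.
Proof.
apply: (polymxM (fun p => frame (p *m K^T)) (fun=> K)); last exact: polymx_cst.
by apply: polymx_comp_lin; exact: frame_poly.
Qed.

Lemma coframe_frame_rot p : coframe_rot p *m frame_rot p = 1%:M.
Proof.
by rewrite /coframe_rot /frame_rot mulmxA -(mulmxA K^T) coframe_frame mulmx1 KTK.
Qed.

Lemma filiform_const_anti i j k :
  filiform_const a b c i j k = - filiform_const a b c j i k.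
Proof.
rewrite /filiform_const.
elim/ord4P: i; elim/ord4P: j; elim/ord4P: k => //=; rewrite ?opprK ?oppr0 //.
Qed.

Lemma partial_coframe i j k p :
  partial i (fun q => coframe q j k) p = evalp (deriv_pexp i (coframe_pexp j k)) p.
Proof.
rewrite (_ : (fun q => _) = evalp (coframe_pexp j k)) ?partial_evalp //.
by apply/funext => q; exact: mxE.
Qed.

Lemma coframe_structure i j k p :
  partial i (fun q => coframe q j k) p - partial j (fun q => coframe q i k) p =
  - \sum_l \sum_m filiform_const a b c l m k * coframe p i l * coframe p j m.
Proof.
rewrite !partial_coframe !sum4E !mxE /filiform_const.
by elim/ord4P: i; elim/ord4P: j; elim/ord4P: k => /=; field.
Qed.

(** [coframe_rot] is the pullback of [coframe] by the linear map [p *m K^T], and exterior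
    derivatives commute with pullback, so the constants are unchanged. *)
Lemma coframe_rot_structure i j k p :
  partial i (fun q => coframe_rot q j k) p - partial j (fun q => coframe_rot q i k) p =
  - \sum_l \sum_m filiform_const a b c l m k * coframe_rot p i l * coframe_rot p j m.
Proof.
pose q := p *m K^T.
have part i' j' : partial i' (fun q => coframe_rot q j' k) p =
    \sum_m \sum_l K m j' * K l i' * partial l (fun q => coframe q m k) q.
  rewrite (_ : (fun q => _) = fun p => \sum_m K m j' * coframe (p *m K^T) m k); last first.
    by apply/funext => r; rewrite mxE; apply: eq_bigr => m _; rewrite mxE.
  have pol m : polyf (fun p => coframe (p *m K^T) m k).
    exact: (polymx_comp_lin _ _ coframe_poly).
  rewrite partial_sum => [|m]; last first.
    by apply: polyf_diff; apply: polyfM; [exact: polyf_cst|exact: pol].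
  apply: eq_bigr => m _; rewrite partialM; last 2 first.
  - exact/polyf_diff/polyf_cst.
  - exact/polyf_diff/pol.
  rewrite partial_cst mul0r add0r (partial_comp_lin _ (fun p => coframe p m k)); last first.
    exact: coframe_poly.
  by rewrite mulr_sumr; apply: eq_bigr => l _; rewrite mxE mulrA.
rewrite !part [X in _ - X]exchange_big -sumrB.
have rotE i' l : coframe_rot p i' l = \sum_m K m i' * coframe q m l.
  by rewrite mxE; apply: eq_bigr => m _; rewrite mxE.
transitivity (\sum_m \sum_l K m j * K l i *
   - \sum_s \sum_t filiform_const a b c s t k * coframe q l s * coframe q m t).
  apply: eq_bigr => m _; rewrite -sumrB; apply: eq_bigr => l _.
  by rewrite -coframe_structure; ring.
rewrite (eq_bigr (fun m => \sum_s \sum_t \sum_l K m j * K l i *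
    - (filiform_const a b c s t k * coframe q l s * coframe q m t))); last first.
  move=> m _; transitivity (\sum_l \sum_s \sum_t  K m j * K l i *
    - (filiform_const a b c s t k * coframe q l s * coframe q m t)).
    apply: eq_bigr => l _; rewrite mulrN mulr_sumr -sumrN; apply: eq_bigr => s _.
    by rewrite mulr_sumr -sumrN; apply: eq_bigr => t _; rewrite mulrN.
  rewrite exchange_big; apply: eq_bigr => s _ /=.
  by rewrite exchange_big.
rewrite exchange_big -sumrN; apply: eq_bigr => s _ /=.
rewrite exchange_big -sumrN; apply: eq_bigr => t _ /=.
rewrite (rotE j) (rotE i) -mulrA mulr_suml mulr_sumr -sumrN exchange_big.
apply: eq_bigr => l _ /=; rewrite !mulr_sumr -sumrN; apply: eq_bigr => m _.
by ring.
Qed.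

Lemma bach_rot p :
  (\matrix_(i, j) bach (left_invariant_metric (rot_bracket filiform)) i j p)%R =
  coframe_rot p *m frame_bachmx (filiform_const a b c) *m (coframe_rot p)^T.
Proof.
apply/matrixP => i j; rewrite mxE left_invariant_metric_rot.
exact: (bach_frame _ _ _ coframe_rot_poly frame_rot_poly coframe_frame_rot
  filiform_const_anti coframe_rot_structure).
Qed.

Lemma coframe0 : coframe 0 = 1%:M.
Proof.
apply/matrixP => i j; rewrite !mxE.
by elim/ord4P: i; elim/ord4P: j => /=; rewrite ?mxE; ring.
Qed.

Lemma bach_endo_rot :
  bach_endo (rot_bracket filiform) =
  K^T *m frame_bachmx (filiform_const a b c) *m K.
Proof. by rewrite [LHS]bach_rot /coframe_rot mul0mx coframe0 mulmx1 trmxK. Qed.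

End FiliformFrame.

(** * Normal form of the orbit *)

Section NormalForm.
Context {R : realType}.

(** Gram-Schmidt from the last row upwards, which makes [S] upper triangular. Then [S] preserves the
    spans of the last basis vectors; these are ideals of the filiform algebra, and so its shape
    survives. *)
Lemma triangular_orthonormalization (m n : nat) (H : 'M[R]_(m, n)) :
  (forall v : 'rV_m, v *m H = 0 -> v = 0) ->
  exists S : 'M[R]_m, (forall i j : 'I_m, (j < i)%N -> S i j = 0) /\
    (S *m H) *m (S *m H)^T = 1%:M.
Proof.
elim: m H => [|m IH]; first by move=> H _; exists 0; split=> [[]//|]; rewrite [LHS]flatmx0 [RHS]flatmx0.
rewrite -[m.+1]/(1 + m)%N => H; rewrite -[H]vsubmxK.
move: (usubmx H) (dsubmx H) => {H} u H inj.
have [|S [Sup SH]] := IH H.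
  move=> v vH; have := inj (row_mx 0 v); rewrite mul_row_col vH mul0mx addr0.
  by move=> /(_ erefl); rewrite -row_mx0 => /eq_row_mx [].
set F := S *m H in SH.
(* The coefficients of [r], the first row minus its projection onto the rows already
   orthonormalized. Their leading 1 forces [r] to be nonzero by injectivity. *)
pose w : 'rV_(1 + m) := row_mx 1%:M (- (u *m F^T *m S)).
pose r := u - u *m F^T *m F.
have wr : w *m col_mx u H = r.
  by rewrite mul_row_col mul1mx mulNmx -(mulmxA _ S).
have rF : r *m F^T = 0 by rewrite mulmxBl -(mulmxA _ F) SH mulmx1 subrr.
clearbody r; pose N := (r *m r^T) 0 0.
have NE : N = \sum_i r 0 i ^+ 2.
  by rewrite /N mxE; apply: eq_bigr => i _; rewrite [r^T _ _]mxE expr2.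
have N_gt0 : 0 < N.
  rewrite lt_def NE sumr_ge0 => [|i _]; last exact: sqr_ge0.
  rewrite andbT; apply/negP => /eqP /psumr_eq0P r0.
  have : w = 0.
    apply: inj; rewrite wr; apply/rowP => i; rewrite mxE.
    by apply/eqP; rewrite -sqrf_eq0 r0 // => j _; exact: sqr_ge0.
  rewrite /w -row_mx0 => /eq_row_mx [/matrixP/(_ 0 0)]; rewrite !mxE /= => /eqP.
  by rewrite oner_eq0.
pose s := (Num.sqrt N)^-1.
have sN : s * s * N = 1.
  by rewrite -expr2 exprVn sqr_sqrtr ?ltW // mulVf // gt_eqF.
exists (col_mx (s *: w) (row_mx 0 S)); split.
  move=> i j; rewrite -(splitK i) -(splitK j).
  case: (fintype.split i) => i'; case: (fintype.split j) => j' /=.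
  - by rewrite (ord1 i') ltn0.
  - by rewrite (ord1 i').
  - by rewrite col_mxEd row_mxEl mxE.
  - by rewrite ltn_add2l col_mxEd row_mxEr; exact: Sup.
rewrite mul_col_mx -scalemxAl wr mul_row_col mul0mx add0r -/F.
rewrite tr_col_mx mul_col_row SH linearZ /= -!scalemxAl -!scalemxAr rF scaler0.
rewrite -[F *m r^T]trmxK trmx_mul trmxK rF trmx0 scaler0 scalerA.
rewrite (scalar_mx_block 1 m 1); congr block_mx.
by apply/matrixP => i j; rewrite !ord1 !mxE eqxx -[in RHS]sN /N mxE.
Qed.

Lemma GL_orbit_normal_form (nu : 'rV[R]_4 -> 'rV[R]_4 -> 'rV[R]_4) :
  GL_orbit (filiform 1 0 1) nu ->
  exists (K : 'M[R]_4) (a b c : R), [/\ K *m K^T = 1%:M, a != 0, c != 0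
    & nu = rot_bracket K (filiform a b c)].
Proof.
move=> [h h_unit nuE].
have [|S [Sup KKT]] := triangular_orthonormalization _ _ h.
  by move=> v vh; rewrite -[v](mulmxK h_unit) vh mul0mx.
set K := S *m h in KKT.
have [K_unit _] := mulmx1_unit KKT.
have S_unit : S \in unitmx by move: K_unit; rewrite unitmx_mul => /andP[].
have KTE : K^T = invmx h *m invmx S.
  have KX : K *m (invmx h *m invmx S) = 1%:M.
    by rewrite /K mulmxA mulmxK // mulmxV.
  by rewrite -[LHS]mulmx1 -KX mulmxA (mulmx1C KKT) mul1mx.
have Sdiag i : S i i != 0.
  have : \det S^T != 0 by rewrite det_tr -unitfE -unitmxE.
  rewrite det_trig; last by apply/is_trig_mxP => j k jk; rewrite mxE Sup.
  by move=> /prodf_neq0 /(_ i isT); rewrite mxE.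
(* These constants solve the requirement that [S] map the bracket [filiform a b c] to
   [filiform 1 0 1], tested on the pairs e_1, e_2 and e_1, e_3. *)
pose a := S o0 o0 * S o1 o1 / S o2 o2.
pose c := S o0 o0 * S o2 o2 / S o3 o3.
pose b := (S o0 o0 * S o1 o2 - a * S o2 o3) / S o3 o3.
exists K, a, b, c; split=> //.
- by rewrite !mulf_neq0 ?invr_eq0.
- by rewrite !mulf_neq0 ?invr_eq0.
have key x y : filiform 1 0 1 (x *m S) (y *m S) = filiform a b c x y *m S.
  have S10 : S o1 o0 = 0 by apply: Sup.
  have S20 : S o2 o0 = 0 by apply: Sup.
  have S30 : S o3 o0 = 0 by apply: Sup.
  have S21 : S o2 o1 = 0 by apply: Sup.
  have S31 : S o3 o1 = 0 by apply: Sup.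
  have S32 : S o3 o2 = 0 by apply: Sup.
  apply/rowP => k; rewrite !(mxE, sum4E) /= S10 S20 S30 S21 S31 S32 /b /c /a.
  have := Sdiag o2; have := Sdiag o3.
  elim/ord4P: k => /= d3 d2; rewrite ?S20 ?S30 ?S21 ?S31 ?S32; field;
    by rewrite ?d2 ?d3.
apply/funext => x; apply/funext => y; rewrite nuE /rot_bracket.
have hK : h = invmx S *m K by rewrite /K mulKmx.
by rewrite [X in _ *m X = _]hK mulmxA -[filiform a b c _ _](mulmxK S_unit) -key KTE !mulmxA !mulmxKV.
Qed.

Lemma linear_row_sum (f : 'rV[R]_4 -> 'rV[R]_4) x :
  linear f -> f x = \sum_i x 0 i *: f (delta_mx 0 i).
Proof.
move=> lf; pose L := GRing.isLinear.Build R 'rV[R]_4 'rV[R]_4 *:%R f lf.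
pose F : {linear 'rV[R]_4 -> 'rV[R]_4} := HB.pack f L.
rewrite -[f]/(F : _ -> _) {1}[x]row_sum_delta linear_sum.
by apply: eq_bigr => i _; rewrite linearZ.
Qed.

Lemma nilpotent_bracket_filiform (mu : 'rV[R]_4 -> 'rV[R]_4 -> 'rV[R]_4) :
  nilpotent_bracket mu ->
  mu (e_ 1) (e_ 2) = e_ 3 -> mu (e_ 1) (e_ 3) = e_ 4 -> mu (e_ 1) (e_ 4) = 0 ->
  mu (e_ 2) (e_ 3) = 0 -> mu (e_ 2) (e_ 4) = 0 -> mu (e_ 3) (e_ 4) = 0 ->
  mu = filiform 1 0 1.
Proof.
move=> [[linr linl] anti _ _].
have e1 : e_ 1 = delta_mx 0 o0 :> 'rV[R]_4.
  by congr delta_mx; apply: val_inj; rewrite /= inordK.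
have e2 : e_ 2 = delta_mx 0 o1 :> 'rV[R]_4.
  by congr delta_mx; apply: val_inj; rewrite /= inordK.
have e3 : e_ 3 = delta_mx 0 o2 :> 'rV[R]_4.
  by congr delta_mx; apply: val_inj; rewrite /= inordK.
have e4 : e_ 4 = delta_mx 0 o3 :> 'rV[R]_4.
  by congr delta_mx; apply: val_inj; rewrite /= inordK.
rewrite e1 e2 e3 e4 => m01 m02 m03 m12 m13 m23.
have mxx x : mu x x = 0.
  by apply/rowP => k; have /rowP/(_ k) := anti x x; rewrite !mxE => ?; lra.
have m10 := anti (delta_mx 0 o1) (delta_mx 0 o0); rewrite m01 in m10.
have m20 := anti (delta_mx 0 o2) (delta_mx 0 o0); rewrite m02 in m20.
have m30 := anti (delta_mx 0 o3) (delta_mx 0 o0); rewrite m03 in m30.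
have m21 := anti (delta_mx 0 o2) (delta_mx 0 o1); rewrite m12 in m21.
have m31 := anti (delta_mx 0 o3) (delta_mx 0 o1); rewrite m13 in m31.
have m32 := anti (delta_mx 0 o3) (delta_mx 0 o2); rewrite m23 in m32.
apply/funext => x; apply/funext => y.
rewrite (linear_row_sum (mu x)) // sum4E.
rewrite !(fun j => linear_row_sum (mu^~ (delta_mx 0 j)) x (linl _)) !sum4E.
rewrite !mxx m01 m02 m03 m12 m13 m23 m10 m20 m30 m21 m31 m32.
by apply/rowP => k; rewrite !mxE; elim/ord4P: k => /=; ring.
Qed.


End NormalForm.

(** * Non-existence of a potential *)

Section Lines.
Context {R : realType}.
Implicit Types (f : 'rV[R]_4 -> R) (p w : 'rV[R]_4).

Lemma is_derive_line f p i (t : R) :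
  differentiable (f : _ -> R^o) (p + t *: delta_mx 0 i) ->
  is_derive (t : R^o) (1 : R^o) (fun t => f (p + t *: delta_mx 0 i) : R^o)
    (partial i f (p + t *: delta_mx 0 i)).
Proof.
move=> dfp; have df := @diff_derivable _ _ _ _ _ (delta_mx 0 i) dfp.
have e : (fun h : R => h^-1 *: (((fun t => f (p + t *: delta_mx 0 i) : R^o) \o shift (t : R^o)) (h *: (1 : R^o))
     - f (p + t *: delta_mx 0 i))) =
   fun h => h^-1 *: ((f \o shift (p + t *: delta_mx 0 i)) (h *: delta_mx 0 i)
                     - f (p + t *: delta_mx 0 i)).
  apply/funext => h /=; congr (_ *: (f _ - _)).
  by rewrite [h *: _](mulr1 h) scalerDl addrCA.
by split; rewrite ?/derivable ?/partial /derive e.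
Qed.

Lemma partial_translate f i p w :
  partial i (fun q => f (q + w)) p = partial i f (p + w).
Proof.
have e : (fun q => f (q + w)) \o shift p = f \o shift (p + w).
  by apply/funext => h /=; rewrite addrA.
by rewrite /partial /derive e.
Qed.

(** Subtracting the affine part leaves a function of one real variable with zero derivative, hence a
    constant. *)
Lemma partial_cst_affine f i s p (t : R) :
  (forall q, differentiable (f : _ -> R^o) q) ->
  (forall q, partial i f q = s) ->
  f (p + t *: delta_mx 0 i) = f p + t * s.
Proof.
move=> df fs.
pose phi (t : R) : R := f (p + t *: delta_mx 0 i) - t * s.
have : phi t = phi 0.
  apply: (@is_derive_0_is_cst R phi t 0) => x.
  have := is_derive_line f p i x (df _); rewrite fs => d1.
  have d2 : is_derive (x : R^o) (1 : R^o) (fun t : R => t * s : R^o) s.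
    have -> : (fun t : R => t * s : R^o) = s \*: (id : R^o -> R^o).
      by apply/funext => y /=; rewrite mulrC.
    by apply: is_derive_eq; rewrite /GRing.scale /= mulr1.
  have := @is_deriveB _ _ _ _ _ _ _ _ _ d1 d2; rewrite subrr.
  exact.
by rewrite /phi scale0r addr0 mul0r subr0 => <-; rewrite subrK.
Qed.

Lemma partial_translation_invariant f i p :
  (forall q, differentiable (f : _ -> R^o) q) ->
  (forall (t : R) q, f (q + t *: delta_mx 0 i) = f q) -> partial i f p = 0.
Proof.
move=> df fi; have := is_derive_line f p i 0 (df _).
rewrite (_ : (fun t : R => _) = cst (f p)); last by apply/funext => t; exact: fi.
by rewrite scale0r addr0 => /@derive_val <-; rewrite derive_cst.
Qed.

End Lines.

(** * The Hessian of a smooth potential in the frame *)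

Section FrameHessian.
Context {R : realType}.
Variables (th E : 'rV[R]_4 -> 'M[R]_4) (C : 'I_4 -> 'I_4 -> 'I_4 -> R).
Hypothesis th_poly : polymx th.
Hypothesis E_poly : polymx E.
Hypothesis thE : forall p, th p *m E p = 1%:M.
Hypothesis C_anti : forall b c a, C b c a = - C c b a.
Hypothesis dth : forall i j a p,
  partial i (fun q => th q j a) p - partial j (fun q => th q i a) p =
  - \sum_b \sum_c C b c a * th p i b * th p j c.
Variables (u : 'rV[R]_4 -> R) (s : 'M[R]_4).
Hypothesis u_smooth : smooth u.
Hypothesis hess : forall i j p,
  hessian (fun q => th q *m (th q)^T) u i j p = (th p *m s *m (th p)^T) i j.

Definition frame_grad (d : 'I_4) (p : 'rV[R]_4) : R :=
  \sum_k E p d k * partial k u p.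

Lemma frame_grad_diff d p : differentiable (frame_grad d : _ -> R^o) p.
Proof.
apply: differentiable_sum_fun => k; apply: differentiableM_fun.
  by apply: polyf_diff; exact: E_poly.
exact: (u_smooth [:: k]).
Qed.

Lemma partial_frame_grad i d p :
  partial i (frame_grad d) p =
  \sum_c th p i c * (s c d + \sum_b frame_conn C c d b * frame_grad b p).
Proof.
have du k q : partial k u q = \sum_b th q k b * frame_grad b q.
  have -> : partial k u q = \sum_l (th q *m E q) k l * partial l u q.
    rewrite thE (bigD1 k) //= mxE eqxx mul1r big1 ?addr0 // => l.
    by rewrite mxE eq_sym => /negbTE->; rewrite mul0r.
  under [RHS]eq_bigr => b _ do rewrite mulr_sumr.
  rewrite [RHS]exchange_big; apply: eq_bigr => l _ /=; rewrite mxE mulr_suml.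
  by apply: eq_bigr => b _; rewrite mulrA.
(* [X d] is the Hessian evaluated on d_i and E_d. The coordinate Hessian is its image under [th],
   and [th] is invertible, so the hypothesis on the Hessian determines it. *)
pose X d := partial i (frame_grad d) p - \sum_b conn_form th C i p d b * frame_grad b p.
have key j : hessian (fun q => th q *m (th q)^T) u i j p = \sum_d th p j d * X d.
  rewrite /hessian (_ : partial j u = fun q => \sum_b th q j b * frame_grad b q); last first.
    by apply/funext => q; exact: du.
  rewrite partial_sum => [|b]; last first.
    apply: differentiableM_fun; last exact: frame_grad_diff.
    by apply: polyf_diff; exact: th_poly.
  have -> : \sum_k christoffel (fun q => th q *m (th q)^T) k i j p * partial k u p =
     \sum_b (Gam th i p *m th p) j b * frame_grad b p.
    under eq_bigr => k _ do rewrite du mulr_sumr.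
    rewrite exchange_big; apply: eq_bigr => b _ /=; rewrite mxE mulr_suml.
    by apply: eq_bigr => k _; rewrite !mxE mulrA.
  rewrite (Gam_frame th E C) //.
  rewrite (eq_bigr (fun b => partial i (fun q => th q j b) p * frame_grad b p
     + th p j b * partial i (frame_grad b) p)); last first.
    move=> b _; rewrite partialM //; last exact: frame_grad_diff.
    by apply: polyf_diff; exact: th_poly.
  rewrite big_split /=.
  rewrite [X in _ - X](eq_bigr (fun b => partial i (fun q => th q j b) p * frame_grad b p
     + (th p *m conn_form th C i p) j b * frame_grad b p)); last first.
    by move=> b _; rewrite [(dmx _ _ _ + _) j b]mxE [dmx i th p j b]mxE mulrDl.
  rewrite big_split opprD addrACA subrr add0r.
  rewrite [X in _ - X](eq_bigr (fun b => \sum_d th p j d * (conn_form th C i p d b * frame_grad b p))); last first.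
    by move=> b _; rewrite mxE mulr_suml; apply: eq_bigr => d' _; rewrite mulrA.
  rewrite exchange_big -sumrB; apply: eq_bigr => d' _ /=.
  by rewrite -mulr_sumr -mulrBr.
have XE : X d = (th p *m s) i d.
  pose Xr : 'rV[R]_4 := \row_d X d.
  have e : Xr *m (th p)^T = row i (th p *m s) *m (th p)^T.
    apply/rowP => j; rewrite -row_mul [RHS]mxE -hess key mxE.
    by apply: eq_bigr => d' _; rewrite !mxE mulrC.
  have /(congr1 (mulmx^~ (E p)^T)) := e.
  rewrite -!mulmxA -trmx_mul (frame_inv th E) // trmx1 !mulmx1.
  by move=> /rowP/(_ d); rewrite !mxE.
have -> : partial i (frame_grad d) p =
    X d + \sum_b conn_form th C i p d b * frame_grad b p by rewrite /X subrK.
rewrite XE mxE.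
rewrite [X in _ + X](eq_bigr (fun b => \sum_c th p i c * (frame_conn C c d b * frame_grad b p))); last first.
  move=> b _; rewrite /conn_form summxE mulr_suml; apply: eq_bigr => c _.
  by rewrite !mxE mulrA.
rewrite exchange_big -big_split; apply: eq_bigr => c _ /=.
by rewrite -mulr_sumr -mulrDr.
Qed.

Lemma frame_deriv_frame_grad c d p :
  \sum_i E p c i * partial i (frame_grad d) p =
  s c d + \sum_b frame_conn C c d b * frame_grad b p.
Proof.
pose Y c := s c d + \sum_b frame_conn C c d b * frame_grad b p.
transitivity (\sum_e (E p *m th p) c e * Y e).
  under [RHS]eq_bigr => e _ do rewrite mxE mulr_suml.
  rewrite [RHS]exchange_big; apply: eq_bigr => i _ /=.
  rewrite partial_frame_grad mulr_sumr.
  by apply: eq_bigr => e _; rewrite mulrA.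
rewrite (frame_inv th E) // (bigD1 c) //= mxE eqxx mul1r big1 ?addr0 // => e.
by rewrite mxE eq_sym => /negbTE->; rewrite mul0r.
Qed.

End FrameHessian.

Section NonGradient.
Context {R : realType}.

Lemma left_invariant_metric_filiform (a b c : R) :
  left_invariant_metric (filiform a b c) = fun p => coframe a b c p *m (coframe a b c p)^T.
Proof.
have := left_invariant_metric_rot a b c 1%:M; rewrite trmx1 mulmx1.
have -> : rot_bracket 1%:M (filiform a b c) = filiform a b c.
  by apply/funext => x; apply/funext => y; rewrite /rot_bracket trmx1 !mulmx1.
move=> -> //; apply/funext => p.
by rewrite /coframe_rot trmx1 mul1mx mulmx1.
Qed.

Lemma bach_filiform (a b c : R) i j p :
  bach (left_invariant_metric (filiform a b c)) i j p =
  (coframe a b c p *m frame_bachmx (filiform_const a b c) *m (coframe a b c p)^T) i j.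
Proof.
rewrite left_invariant_metric_filiform.
exact: (bach_frame _ _ _ (coframe_poly a b c) (frame_poly a b c) (coframe_frame a b c)
  (filiform_const_anti a b c) (coframe_structure a b c)).
Qed.

Lemma laplacian_filiform (a b c : R) p :
  laplacian (left_invariant_metric (filiform a b c))
    (scalar_curvature (left_invariant_metric (filiform a b c))) p = 0.
Proof.
rewrite left_invariant_metric_filiform.
exact: (laplacian_scalar_curvature_frame _ _ _ (coframe_poly a b c) (frame_poly a b c)
  (coframe_frame a b c) (filiform_const_anti a b c) (coframe_structure a b c)).
Qed.

Lemma filiform_not_gradient :
  ~ gradient_soliton (left_invariant_metric (filiform (1 : R) 0 1)).
Proof.
move=> [u [lam [u_smooth uE]]].
pose th := coframe (1 : R) 0 1; pose E := frame (1 : R) 0 1.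
pose C := filiform_const (1 : R) 0 1.
pose s : 'M[R]_4 := 2^-1 *: (frame_bachmx C - lam%:M).
have hess i j p : hessian (fun q => th q *m (th q)^T) u i j p = (th p *m s *m (th p)^T) i j.
  have := uE i j p; rewrite laplacian_filiform mul0r mul0r addr0 bach_filiform.
  rewrite left_invariant_metric_filiform -/th -/C => e.
  rewrite /s -scalemxAr -scalemxAl mulmxBr mulmxBl mul_mx_scalar -scalemxAl.
  move: e; set h := hessian _ _ _ _ _; set B := th p *m _ *m _.
  by rewrite !mxE => ->; field.
pose v := frame_grad E u.
have dv d p : differentiable (v d : _ -> R^o) p.
  exact: (frame_grad_diff E (frame_poly 1 0 1)).
have Ev c d p : \sum_i E p c i * partial i (v d) p =
    s c d + \sum_b frame_conn C c d b * v b p.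
  exact: (frame_deriv_frame_grad th E C (coframe_poly _ _ _) (frame_poly _ _ _)
    (coframe_frame _ _ _) (filiform_const_anti _ _ _) (coframe_structure _ _ _)).
have sE c d : s c d = 2^-1 * (filiform_bachmx_nat 1 0 1 c d - lam *+ (c == d)).
  by rewrite !mxE -filiform_bach [frame_bachmx _ _ _]mxE.
move: s hess sE Ev => s _ sE Ev; clearbody v.
have E3 f p : \sum_i E p o3 i * partial i f p = partial o3 f p.
  have E3k k : E p o3 k = (o3 == k)%:R by rewrite mxE; elim/ord4P: k.
  rewrite (bigD1 o3) //= E3k mul1r big1 ?addr0 // => k.
  by rewrite eq_sym E3k => /negbTE ->; rewrite mul0r.
(* The frame coefficients do not involve the last coordinate, reflecting that e_4 is central. *)
have Einv c i p t : E (p + t *: delta_mx 0 o3) c i = E p c i.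
  by rewrite !mxE; elim/ord4P: c; elim/ord4P: i => //=; rewrite !mxE /= !mulr0 !addr0.
have v3 p t : v o3 (p + t *: delta_mx 0 o3) = v o3 p + t * s o3 o3.
  apply: partial_cst_affine => // q; rewrite -E3 Ev sum4E /frame_conn /C /filiform_const /=.
  by ring.
have dv3 i p t : partial i (v o3) (p + t *: delta_mx 0 o3) = partial i (v o3) p.
  rewrite -partial_translate.
  rewrite (_ : (fun q => _) = fun q => v o3 q + (fun=> t * s o3 o3) q); last first.
    by apply/funext => q; exact: v3.
  by rewrite partialD ?partial_cst ?addr0 //; exact/polyf_diff/polyf_cst.
(* With indices counted from 0, the equation used is E_0 v_3 = s_03 - v_2 / 2, whose left side is
   invariant along e_4. *)
have v2 t p : v o2 (p + t *: delta_mx 0 o3) = v o2 p.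
  have := Ev o0 o3 (p + t *: delta_mx 0 o3).
  under eq_bigr => i _ do rewrite Einv dv3.
  rewrite Ev !sum4E /frame_conn /C /filiform_const /= => e.
  lra.
(* Here E_3 v_2 = s_32 + v_0 / 2, where s_32 = 0. *)
have v0 p : v o0 p = 0.
  have : partial o3 (v o2) p = 0 by apply: partial_translation_invariant.
  rewrite -E3 Ev sE !sum4E /frame_conn /C /filiform_const /=.
  lra.
have v0_cst i p : partial i (v o0) p = 0.
  by rewrite (_ : v o0 = fun=> 0) ?partial_cst //; apply/funext.
have s00 : s o0 o0 = 0.
  have := Ev o0 o0 0; rewrite big1 => [|i _]; last by rewrite v0_cst mulr0.
  rewrite !sum4E /frame_conn /C /filiform_const /=.
  lra.
(* Here E_1 v_0 = s_10 - v_2 / 2, where s_10 = 0. *)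
have v2_0 p : v o2 p = 0.
  have := Ev o1 o0 p; rewrite big1 => [|i _]; last by rewrite v0_cst mulr0.
  rewrite sE !sum4E /frame_conn /C /filiform_const /=.
  lra.
have s22 : s o2 o2 = 0.
  have := Ev o2 o2 0; rewrite (_ : v o2 = fun=> 0); last by apply/funext.
  rewrite big1 => [|i _]; last by rewrite partial_cst mulr0.
  rewrite !sum4E /frame_conn /C /filiform_const /=.
  lra.
(* The two equations would require [lam] to equal both 7/8 and -7/24. *)
by move: s00 s22; rewrite !sE /=; lra.
Qed.

End NonGradient.

(** * The soliton and its uniqueness *)

Section Soliton.
Context {R : realType}.

Lemma coframe_riemannian_metric (th E : 'rV[R]_4 -> 'M[R]_4) :
  polymx th -> (forall p, th p *m E p = 1%:M) ->
  riemannian_metric (fun p => th p *m (th p)^T).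
Proof.
move=> th_poly thE; split.
- move=> i j; apply: polyf_smooth.
  by apply: (polymxM th (fun p => (th p)^T)) => //; exact: polymxT.
- by move=> p; rewrite trmx_mul trmxK.
- move=> p v v0; rewrite mulmxA -mulmxA -trmx_mul.
  set w := v *m th p.
  have wE : (w *m w^T) 0 0 = \sum_i w 0 i ^+ 2.
    by rewrite mxE; apply: eq_bigr => i _; rewrite [w^T _ _]mxE expr2.
  rewrite wE lt_def sumr_ge0 => [|i _]; last exact: sqr_ge0.
  rewrite andbT; apply: contraNneq v0 => /eqP; rewrite eq_sym => /eqP/esym.
  move=> /psumr_eq0P r0.
  have w0 : w = 0.
    apply/rowP => i; rewrite [RHS]mxE; apply/eqP.
    by rewrite -sqrf_eq0 r0 // => j _; exact: sqr_ge0.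
  by rewrite -[v]mulmx1 -(thE p) mulmxA -/w w0 mul0mx.
Qed.

Lemma complete_diagonal_field (d : 'I_4 -> R) :
  complete_field (fun p : 'rV[R]_4 => \row_k (d k * p 0 k)).
Proof.
move=> p; exists (fun t => \row_k (p 0 k * expR (d k * t))); split.
  by apply/rowP => k; rewrite mxE mulr0 expR0 mulr1.
move=> t.
have dk i k : is_derive (t : R^o) (1 : R^o)
    (fun t => (\row_k (p 0 k * expR (d k * t)) : 'rV[R]_4) i k : R^o)
    (d k * (p 0 k * expR (d k * t))).
  rewrite (_ : (fun _ => _) = fun t => p 0 k * expR (d k * t)); last first.
    by apply/funext => s; rewrite mxE.
  have de : is_derive (t : R^o) (1 : R^o) (fun t : R => d k * t : R^o) (d k).
    have -> : (fun t : R => d k * t : R^o) = d k \*: (id : R^o -> R^o) by [].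
    by apply: is_derive_eq; rewrite /GRing.scale /= mulr1.
  have := is_derive1_comp (is_derive_expR (d k * t)) de.
  move=> /(@is_deriveZ _ _ _ _ (p 0 k)) h; apply: is_derive_eq.
  by rewrite /GRing.scale /=; ring.
have dgam : derivable (fun t : R^o => \row_k (p 0 k * expR (d k * t)) : 'rV[R]_4) t 1.
  by apply/derivable_mxP => i k; have [] := dk i k.
split=> //; rewrite derive_mx //; apply/matrixP => i k; rewrite !mxE.
by have [_] := dk i k.
Qed.

Definition metric_pexp (i j : nat) : @pexp R :=
  let m k := Mul (coframe_pexp 1 0 1 i k) (coframe_pexp 1 0 1 j k) in
  Add (m 0%N) (Add (m 1%N) (Add (m 2%N) (m 3%N))).

Lemma metric_pexpE (i j : 'I_4) :
  (fun p => left_invariant_metric (filiform (1 : R) 0 1) p i j) = evalp (metric_pexp i j).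
Proof.
by apply/funext => p; rewrite left_invariant_metric_filiform !(sum4E, mxE).
Qed.

(* Half of the diagonal derivation B - 35 / 24. *)
Definition soliton_weight (k : 'I_4) : R :=
  nth 0 [:: - (7 / 24); - (7 / 12); - (7 / 8); - (7 / 6)] k.

(** For a = c = 1 and b = 0 the matrix B is diag (7/8, 7/24, -7/24, -7/8). A diagonal derivation
    satisfies d_3 = d_1 + d_2, which forces the constant B_11 + B_22 - B_33 = 35/24. The field takes
    half the derivation because the Lie derivative of the metric counts a symmetric endomorphism
    twice. *)
Lemma filiform_bach_soliton :
  bach_soliton (left_invariant_metric (filiform (1 : R) 0 1)) (35 / 24)
    (fun p => \row_k (soliton_weight k * p 0 k)).
Proof.
split.
- rewrite left_invariant_metric_filiform.
  exact: (coframe_riemannian_metric _ _ (coframe_poly 1 0 1) (coframe_frame 1 0 1)).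
- move=> i; apply: polyf_smooth; exists (Mul (Cst (soliton_weight i)) (Var i)).
  by apply/funext => p; rewrite mxE.
- exact: complete_diagonal_field.
- move=> i j p; rewrite laplacian_filiform mul0r mul0r addr0 bach_filiform.
  have lieE : lie_metric (left_invariant_metric (filiform (1 : R) 0 1))
      (fun p => \row_k (soliton_weight k * p 0 k)) i j p =
    \sum_k (soliton_weight k * p 0 k * evalp (deriv_pexp k (metric_pexp i j)) p
      + evalp (metric_pexp k j) p * (soliton_weight k * (i == k)%:R)
      + evalp (metric_pexp i k) p * (soliton_weight k * (j == k)%:R)).
    have XE k l : partial l (fun q : 'rV[R]_4 =>
        (\row_k (soliton_weight k * q 0 k) : 'rV[R]_4) 0 k) p = soliton_weight k * (l == k)%:R.
      rewrite (_ : (fun _ => _) = evalp (Mul (Cst (soliton_weight k)) (Var k))); last first.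
        by apply/funext => q; rewrite mxE.
      by rewrite partial_evalp /= mul0r add0r.
    apply: eq_bigr => k _; rewrite !XE metric_pexpE partial_evalp -!metric_pexpE.
    by rewrite [(\row__ _) 0 k]mxE.
  rewrite {}lieE.
  rewrite (_ : left_invariant_metric _ p i j = evalp (metric_pexp i j) p); last first.
    by rewrite -metric_pexpE.
  rewrite mxE; under eq_bigr => k _ do rewrite !(mxE, sum4E).
  rewrite !sum4E.
  have BE k l : frame_bach (filiform_const (1 : R) 0 1) k l = filiform_bachmx_nat 1 0 1 k l.
    by rewrite -filiform_bach mxE.
  rewrite !BE.
  by elim/ord4P: i; elim/ord4P: j; rewrite /soliton_weight /=; field.
Qed.

Lemma filiform_algebraic_bach_soliton :
  algebraic_bach_soliton (filiform (1 : R) 0 1).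
Proof.
exists (35 / 24), (bach_endo (filiform (1 : R) 0 1) - (35 / 24)%:M).
split; last by rewrite addrC subrK.
have -> : bach_endo (filiform (1 : R) 0 1) = frame_bachmx (filiform_const 1 0 1).
  apply/matrixP => i j; rewrite [LHS]mxE bach_filiform coframe0.
  by rewrite trmx1 mulmx1 mul1mx.
move=> x y; apply/rowP => k; rewrite !(mxE, sum4E).
have BE k' l : frame_bach (filiform_const (1 : R) 0 1) k' l = filiform_bachmx_nat 1 0 1 k' l.
  by rewrite -filiform_bach mxE.
by elim/ord4P: k; rewrite /= ?mxE ?sum4E ?mxE !BE /=; field.
Qed.

(** Conjugating by [K] turns the condition into one on the explicit Bach matrix. Three scalar
    equations of the derivation rule suffice: two on the pair e_1, e_3 and one on e_1, e_2. *)
Lemma algebraic_bach_soliton_rot (K : 'M[R]_4) (a b c : R) :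
  K *m K^T = 1%:M -> a != 0 -> c != 0 ->
  algebraic_bach_soliton (rot_bracket K (filiform a b c)) ->
  b = 0 /\ a ^+ 2 = c ^+ 2.
Proof.
move=> KKT a0 c0 [lam [D [Dder]]]; rewrite bach_endo_rot // => BE.
pose M : 'M[R]_4 := frame_bachmx (filiform_const a b c) - lam%:M.
have DM : D = K^T *m M *m K.
  rewrite mulmxBr mulmxBl BE mul_mx_scalar -scalemxAl (mulmx1C KKT) scalemx1.
  by rewrite addrC addKr.
have KKv (v : 'rV[R]_4) : v *m K *m K^T = v by rewrite -mulmxA KKT mulmx1.
have Mder x y : filiform a b c x y *m M = filiform a b c (x *m M) y + filiform a b c x (y *m M).
  have := Dder (x *m K) (y *m K); rewrite /rot_bracket !KKv DM.
  rewrite !mulmxA !KKv => /(congr1 (mulmx^~ K^T)).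
  by rewrite mulmxDl !KKv.
have ME (k l : 'I_4) : M k l = filiform_bachmx_nat a b c k l - lam *+ (k == l).
  by rewrite /M [LHS]mxE -filiform_bach; congr (_ + _); rewrite !mxE.
clearbody M; have fil02 : filiform a b c (delta_mx 0 o0) (delta_mx 0 o2) = c *: delta_mx 0 o3.
  by apply/rowP => k; rewrite !mxE; elim/ord4P: k => /=; ring.
have fil01 : filiform a b c (delta_mx 0 o0) (delta_mx 0 o1) =
    a *: delta_mx 0 o2 + b *: delta_mx 0 o3.
  by apply/rowP => k; rewrite !mxE; elim/ord4P: k => /=; ring.
have := Mder (delta_mx 0 o0) (delta_mx 0 o2).
rewrite fil02 -scalemxAl -!rowE => /rowP E02.
have := Mder (delta_mx 0 o0) (delta_mx 0 o1).
rewrite fil01 mulmxDl -!scalemxAl -!rowE => /rowP/(_ o2) e3.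
have e1 := E02 o2; have e2 := E02 o3; move: {E02} e1 e2 e3.
rewrite !mxE /= !ME /= !mulr0n !mulr1n !(mulr0, mul0r, mulr1, mul1r) => e1 e2 e3.
have N0 : a ^+ 2 + b ^+ 2 + c ^+ 2 != 0.
  have a2 : 0 < a ^+ 2 by rewrite exprn_even_gt0.
  have := sqr_ge0 b; have := sqr_ge0 c => ? ?.
  by rewrite gt_eqF //; lra.
have b0 : b = 0.
  (* The e_3 component on the pair e_1, e_3 involves only off-diagonal entries, so [lam] is absent
     from it. *)
  have : a * c * (a ^+ 2 + b ^+ 2 + c ^+ 2) * b = 0 by lra.
  by move/eqP; rewrite !mulf_eq0 (negbTE a0) (negbTE c0) (negbTE N0) => /eqP.
split=> //; move: e2 e3; rewrite b0 => e2 e3.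
pose B i := filiform_bachmx_nat a 0 c i i.
have e2' : B 3%N - lam = B 0%N - lam + (B 2%N - lam).
  by apply: (mulfI c0); rewrite /B /=; lra.
have e3' : B 2%N - lam = B 0%N - lam + (B 1%N - lam).
  by apply: (mulfI a0); rewrite /B /=; lra.
(* Eliminating [lam] gives B_44 - 2 B_33 + B_22 = 0. The mixed terms cancel in it and 2 (a^4 - c^4)
   remains. *)
have : (a ^+ 2 - c ^+ 2) * (a ^+ 2 + c ^+ 2) = 0.
  by move: e2' e3'; rewrite /B /=; lra.
move/eqP; rewrite mulf_eq0 => /orP[|]; first by rewrite subr_eq0 => /eqP.
by move: N0; rewrite b0 expr0n addr0 => /negbTE ->.
Qed.

Lemma isometric_linear (g1 g2 : 'rV[R]_4 -> 'M[R]_4) (A : 'M[R]_4) :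
  A \in unitmx -> (forall p, A *m g2 (p *m A) *m A^T = g1 p) -> isometric g1 g2.
Proof.
move=> A_unit gA.
have coordM (M : 'M[R]_4) k : polyf (fun q : 'rV[R]_4 => (q *m M) 0 k).
  exact: (polyf_comp_lin (fun q : 'rV[R]_4 => q 0 k) _ (polyf_coord k)).
exists (mulmx^~ A), (mulmx^~ (invmx A)); split.
- by move=> i; apply: polyf_smooth; exact: coordM.
- by move=> i; apply: polyf_smooth; exact: coordM.
- by move=> p; rewrite mulmxK.
- by move=> p; rewrite mulmxKV.
- move=> p; have -> : 'J (mulmx^~ A) p = A; last exact: gA.
  apply/matrixP => i j; rewrite jacobian_polyf; last exact: coordM.
  rewrite (partial_comp_lin _ (fun q : 'rV[R]_4 => q 0 j)); last exact: polyf_coord.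
  rewrite (bigD1 j) //= partial_coord eqxx mulr1 big1 ?addr0 // => k kj.
  by rewrite partial_coord (negbTE kj) mulr0.
Qed.

(** A Lie algebra isomorphism is also one of the groups in these coordinates, so a linear
    isomorphism that is a homothety of inner products makes the left-invariant metrics
    homothetic. *)
Lemma algebraic_bach_soliton_isometric (K : 'M[R]_4) (a c : R) :
  K *m K^T = 1%:M -> a != 0 -> a ^+ 2 = c ^+ 2 ->
  exists2 k : R, 0 < k &
    isometric (left_invariant_metric (rot_bracket K (filiform a 0 c)))
              (fun p => k *: left_invariant_metric (filiform 1 0 1) p).
Proof.
move=> KKT a0 ac.
have c0 : c != 0 by rewrite -sqrf_eq0 -ac sqrf_eq0.
have KTK := mulmx1C KKT.
exists (a ^- 2); first by rewrite invr_gt0 exprn_even_gt0.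
(* [L] carries [filiform a 0 c] to [filiform 1 0 1]. Its last entry is a or -a since a^2 = c^2; this
   absorbs the relative sign of a and c and makes [L] a homothety of ratio |a|, whence the factor
   a^-2. *)
pose L : 'M[R]_4 := diag_mx (\row_k nth 0 [:: a; a; a; a ^+ 2 / c] k).
have LL : L *m L^T = (a ^+ 2)%:M.
  apply/matrixP => i j; rewrite !(mxE, sum4E).
  elim/ord4P: i; elim/ord4P: j; rewrite /= ?mulr0n ?mulr1n; try by ring.
  by rewrite ac; field.
have KL_unit : K^T *m L \in unitmx.
  have : (K^T *m L) *m (a ^- 2 *: (L^T *m K)) = 1%:M.
    rewrite -scalemxAr mulmxA -(mulmxA K^T) LL mul_mx_scalar -scalemxAl KTK.
    by rewrite scalerA mulVf ?scale1r // expf_neq0.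
  by case/mulmx1_unit.
apply: (isometric_linear _ _ (K^T *m L)) => // p.
rewrite left_invariant_metric_rot // left_invariant_metric_filiform.
set q := p *m K^T.
have qL k : (q *m L) 0 k = q 0 k * nth 0 [:: a; a; a; a ^+ 2 / c] k.
  by rewrite mul_mx_diag !mxE.
have Lth : L *m coframe 1 0 1 (q *m L) = coframe a 0 c q *m L.
  rewrite mul_diag_mx [RHS]mul_mx_diag; apply/matrixP => i j.
  rewrite [LHS]mxE [RHS]mxE [coframe _ _ _ _ i j]mxE [coframe _ _ _ _ i j]mxE ![(\row__ _) _ _]mxE.
  by elim/ord4P: i; elim/ord4P: j; rewrite /= ?qL /=; field.
rewrite /coframe_rot -/q mulmxA -scalemxAr -scalemxAl !mulmxA.
rewrite -(mulmxA K^T L) Lth !trmx_mul !trmxK -/q.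
rewrite -(mulmxA _ _ (L^T *m K)) (mulmxA _ L^T) -trmx_mul Lth trmx_mul !mulmxA.
rewrite -(mulmxA _ L L^T) LL mul_mx_scalar -!scalemxAl scalerA mulVf ?scale1r //.
by rewrite expf_neq0.
Qed.

End Soliton.

Theorem theorem2 (R : realType) (mu : 'rV[R]_4 -> 'rV[R]_4 -> 'rV[R]_4)
    (hmu : nilpotent_bracket mu)
    (h12 : mu (e_ 1) (e_ 2) = e_ 3) (h13 : mu (e_ 1) (e_ 3) = e_ 4)
    (h14 : mu (e_ 1) (e_ 4) = 0) (h23 : mu (e_ 2) (e_ 3) = 0)
    (h24 : mu (e_ 2) (e_ 4) = 0) (h34 : mu (e_ 3) (e_ 4) = 0) :
  (exists (lam : R) (X : 'rV[R]_4 -> 'rV[R]_4),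
     bach_soliton (left_invariant_metric mu) lam X /\ 0 < lam) /\
  ~ gradient_soliton (left_invariant_metric mu) /\
  algebraic_bach_soliton mu /\
  (forall nu : 'rV[R]_4 -> 'rV[R]_4 -> 'rV[R]_4,
     GL_orbit mu nu -> algebraic_bach_soliton nu ->
     exists2 c : R, 0 < c &
       isometric (left_invariant_metric nu)
                 (fun p => c *: left_invariant_metric mu p)).
Proof.
rewrite (nilpotent_bracket_filiform _ hmu h12 h13 h14 h23 h24 h34).
split; [|split; [|split]].
- exists (35 / 24), (fun p => \row_k (soliton_weight k * p 0 k)).
  by split; [exact: filiform_bach_soliton|lra].
- exact: filiform_not_gradient.
- exact: filiform_algebraic_bach_soliton.
- move=> nu /GL_orbit_normal_form[K [a [b [c [KKT a0 c0 ->]]]]].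
  move=> /(algebraic_bach_soliton_rot _ _ _ _ KKT a0 c0)[-> ac].
  exact: algebraic_bach_soliton_isometric.
Qed.
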